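(* The quantum big cell $\mathcal{O}_q(U_{12})$ admits a coaction $\tilde\Delta:\mathcal{O}_q(U_{12})\to\mathcal{O}(P_{l,q})\otimes\mathcal{O}_q(U_{12})$ of $\mathcal{O}(P_{l,q})$, obtained by restricting the comultiplication of $\mathcal{O}(P_{l,q})$. Explicitly, for $i\in\{3,4\}$ and $j\in\{1,2\}$, $$\tilde\Delta t_{ij}=t_{ij}\otimes 1+\sum_{a,b}y_{ia}S(x)_{bj}\otimes t_{ab}+\sum_{a,b}y_{ia}\eta_aS(x)_{bj}\otimes\tilde\tau_b,$$ $$\tilde\Delta\tilde\tau_j=\sum_{a}(d\otimes 1)\Big(\tau_a\otimes 1+\sum_b\xi_b\otimes t_{ba}+1\otimes\tilde\tau_a\Big)(S(x)_{aj}\otimes 1).$$ Here, in the first formula, $a$ runs over $\{3,4\}$ and $b$ over $\{1,2\}$; in the second, $a$ runs over $\{1,2\}$ and $b$ over $\{3,4\}$.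
   Context: $\mathbb{C}_q=\mathbb{C}[q,q^{-1}]$ with $q$ an indeterminate; tensor products are over $\mathbb{C}_q$ and are tensor products of superalgebras. Put $p(i)=0$ for $1\le i\le 4$ and $p(5)=1$. The quantum matrix superalgebra $\mathrm{M}_q(4|1)$ is the $\mathbb{C}_q$-superalgebra generated by $a_{ij}$, $1\le i,j\le 5$, of parity $\pi(a_{ij})=p(i)+p(j)$ mod $2$, subject to $a_{ij}^2=0$ for odd $a_{ij}$ and - $a_{ij}a_{il}=(-1)^{\pi(a_{ij})\pi(a_{il})}q^{(-1)^{p(i)+1}}a_{il}a_{ij}$ for $j<l$; - $a_{ij}a_{kj}=(-1)^{\pi(a_{ij})\pi(a_{kj})}q^{(-1)^{p(j)+1}}a_{kj}a_{ij}$ for $i<k$; - $a_{ij}a_{kl}=(-1)^{\pi(a_{ij})\pi(a_{kl})}a_{kl}a_{ij}$ for $i<k,\ j>l$ or $i>k,\ j<l$; - $a_{ij}a_{kl}-(-1)^{\pi(a_{ij})\pi(a_{kl})}a_{kl}a_{ij}=(-1)^{\pi(a_{ij})\pi(a_{kj})}(q^{-1}-q)a_{kj}a_{il}$ for $i<k,\ j<l$. Let $D_1=\sum_{\sigma\in S_4}(-q)^{-\ell(\sigma)}a_{1\sigma(1)}\cdots a_{4\sigma(4)}$ and $D_2=a_{55}$. $\mathrm{GL}_q(4|1)=\mathrm{M}_q(4|1)[D_1^{-1},D_2^{-1}]$ is obtained by adjoining even two-sided inverses of $D_1,D_2$, and $\mathcal{O}(\mathrm{SL}_q(4|1))=\mathrm{GL}_q(4|1)/\langle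 \mathrm{Ber}_q-1\rangle$, where $\mathrm{Ber}_q=\Big(\sum_{\sigma\in S_4}(-q)^{-\ell(\sigma)}s_{1\sigma(1)}\cdots s_{4\sigma(4)}\Big)a_{55}^{-1}$ with $s_{ij}=a_{ij}-a_{i5}a_{55}^{-1}a_{5j}$. It is a Hopf superalgebra with $\Delta(a_{ij})=\sum_ka_{ik}\otimes a_{kj}$, counit $\epsilon(a_{ij})=\delta_{ij}$ and antipode $S$. Write $g_{ij}$ for the even generators $a_{ij}$ and $\gamma_{ij}$ for the odd ones. $\mathcal{O}(P_{l,q})=\mathcal{O}(\mathrm{SL}_q(4|1))/\mathcal{I}_q$, where $\mathcal{I}_q$ is the two-sided ideal generated by $g_{13},g_{14},g_{23},g_{24},\gamma_{15},\gamma_{25}$; it is a Hopf superalgebra with the induced structure. In it the quantum determinants $g_{11}g_{22}-q^{-1}g_{12}g_{21}$ and $g_{33}g_{44}-q^{-1}g_{34}g_{43}$ are invertible, so the matrices $x,y$ below are invertible. New variables in $\mathcal{O}(P_{l,q})$ are defined by $$x=\begin{pmatrix}g_{11}&g_{12}\\ g_{21}&g_{22}\end{pmatrix},\quad y=\begin{pmatrix}g_{33}&g_{34}\\ g_{43}&g_{44}\end{pmatrix},\quad d=g_{55},\quad tx=\begin{pmatrix}g_{31}&g_{32}\\ g_{41}&g_{42}\end{pmatrix},$$ $$\tilde\tau x=(\gamma_{51},\gamma_{52}),\quad d\tau=\tilde\tau x,\quad d\xi=(\gamma_{53},\gamma_{54}),\quad y\eta=\begin{pmatrix}\gamma_{35}\\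 \gamma_{45}\end{pmatrix}.$$ The rows of $t$, the rows and columns of $y$, the entries of $\eta$ and the entries of $\xi$ are indexed by $\{3,4\}$; the columns of $t$, the rows and columns of $x$, and the entries of $\tau$ and $\tilde\tau$ are indexed by $\{1,2\}$. $S(x)_{ij}=S(x_{ij})$, i.e. $S(x)=x^{-1}$. The quantum big cell $\mathcal{O}_q(U_{12})$ is the subring of $\mathcal{O}(P_{l,q})$ generated by the entries of $t$ and $\tilde\tau$. *)

(* Defs.v *)
From HB Require Import structures.
From mathcomp Require Import all_boot all_order all_algebra perm.
From mathcomp Require Import boolp reals complex monalg.

Set Implicit Arguments.
Unset Strict Implicit.
Unset Printing Implicit Defensive.

Import GRing.Theory.
Local Open Scope ring_scope.
Local Open Scope quotient_scope.

(* Laurent polynomials F[q, q^-1], as the subring of F(q) of all fractions     *)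
(* p / q^n with p a polynomial.                                                *)

Section Laurent.
Variable F : fieldType.
Local Notation "x %:F" := (@tofrac {poly F} x).
Local Notation Fq := {fraction {poly F}}.

Definition laurent_pred : {pred Fq} :=
  fun f => `[< exists (n : nat) (p : {poly F}), f * ('X%:F) ^+ n = p%:F >].

Lemma laurent_subring : subring_closed laurent_pred.
Proof.
split.
- by apply/asboolP; exists 0%N, 1; rewrite expr0 mulr1 tofrac1.
- move=> f g /asboolP[n [p Ep]] /asboolP[m [r Er]]; apply/asboolP.
  exists (n + m)%N, (p * 'X^m - r * 'X^n).
  rewrite mulrBl tofracB !tofracM !tofracXn -Ep -Er exprD mulrA; congr (_ - _).
  by rewrite mulrCA mulrC.
- move=> f g /asboolP[n [p Ep]] /asboolP[m [r Er]]; apply/asboolP.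
  by exists (n + m)%N, (p * r); rewrite tofracM -Ep -Er exprD mulrACA.
Qed.

HB.instance Definition _ :=
  GRing.isSubringClosed.Build _ laurent_pred laurent_subring.

Record laurent := Laurent {
  laurent_val : Fq;
  laurent_valP : laurent_val \in laurent_pred }.

HB.instance Definition _ := [isSub for laurent_val].
HB.instance Definition _ := [Choice of laurent by <:].
HB.instance Definition _ :=
  [SubChoice_isSubComNzRing of laurent by <:].

Lemma laurent_q_subproof : 'X%:F \in laurent_pred.
Proof. by apply/asboolP; exists 0%N, 'X; rewrite expr0 mulr1. Qed.

Lemma laurent_qV_subproof : ('X%:F)^-1 \in laurent_pred.
Proof.
apply/asboolP; exists 1%N, 1; rewrite expr1 tofrac1 mulVf //.
by rewrite tofrac_eq0 polyX_eq0.
Qed.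

Definition laurent_q : laurent := Laurent laurent_q_subproof.
Definition laurent_qV : laurent := Laurent laurent_qV_subproof.

Lemma laurent_qK : laurent_q * laurent_qV = 1.
Proof.
by apply: val_inj; rewrite /= divff // tofrac_eq0 polyX_eq0.
Qed.

End Laurent.

(* A K-superalgebra: sa_hpart false and sa_hpart true are the projections onto *)
(* the even and the odd part.  The zero ring is allowed, which rules out       *)
(* algType; the ring and K-module structures are therefore bundled here and    *)
(* given back to the carrier below.                                            *)

Record superAlgType (K : comNzRingType) := SuperAlg {
  sa_ring : pzRingType;
  sa_scale : K -> sa_ring -> sa_ring;
  sa_scaleA : forall k l x, sa_scale k (sa_scale l x) = sa_scale (k * l) x;
  sa_scale1 : left_id 1 sa_scale;
  sa_scaleDr : right_distributive sa_scale +%R;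
  sa_scaleDl : forall x, {morph sa_scale^~ x : k l / k + l};
  sa_scaleAl : forall k x y, sa_scale k (x * y) = sa_scale k x * y;
  sa_scaleAr : forall k x y, sa_scale k (x * y) = x * sa_scale k y;
  sa_hpart : bool -> sa_ring -> sa_ring;
  sa_hpartP : forall b k x y,
    sa_hpart b (sa_scale k x + y) = sa_scale k (sa_hpart b x) + sa_hpart b y;
  sa_hpartD : forall x, sa_hpart false x + sa_hpart true x = x;
  sa_hpartK : forall b c x,
    sa_hpart b (sa_hpart c x) = if b == c then sa_hpart c x else 0;
  sa_hpart1 : sa_hpart false 1 = 1;
  sa_hpartM : forall b c x y,
    sa_hpart (b (+) c) (sa_hpart b x * sa_hpart c y) =
    sa_hpart b x * sa_hpart c y }.

Definition sa_sort (K : comNzRingType) (A : superAlgType K) : Type :=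
  sa_ring A.
Coercion sa_sort : superAlgType >-> Sortclass.

HB.instance Definition _ (K : comNzRingType) (A : superAlgType K) :=
  GRing.PzRing.copy (sa_sort A) (sa_ring A).
HB.instance Definition _ (K : comNzRingType) (A : superAlgType K) :=
  GRing.Zmodule_isLmodule.Build K (sa_sort A)
    (@sa_scaleA K A) (@sa_scale1 K A) (@sa_scaleDr K A) (@sa_scaleDl K A).

Definition hpart (K : comNzRingType) (A : superAlgType K) (b : bool) :
  A -> A := @sa_hpart K A b.

Definition homogeneous (K : comNzRingType) (A : superAlgType K) (b : bool)
  (x : A) : Prop := hpart b x = x.

Record super_morphism (K : comNzRingType) (A B : superAlgType K) (f : A -> B)
    : Prop := SuperMorphism {
  super_morphism_linear : linear f;
  super_morphism_monoid : monoid_morphism f;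
  super_morphism_hpart : forall b x, f (hpart b x) = hpart b (f x) }.

Section SuperTheory.
Variables (K : comNzRingType) (A : superAlgType K).
Implicit Types x y : A.

Lemma super_scalerAl (k : K) x y : k *: (x * y) = (k *: x) * y.
Proof. exact: sa_scaleAl. Qed.

Lemma super_scalerAr (k : K) x y : k *: (x * y) = x * (k *: y).
Proof. exact: sa_scaleAr. Qed.

Lemma hpart_is_linear b : linear (@hpart K A b).
Proof. by move=> k x y; apply: sa_hpartP. Qed.

HB.instance Definition _ b := GRing.isLinear.Build K A A _ (@hpart K A b)
  (hpart_is_linear b).

Lemma hpartD x : hpart false x + hpart true x = x.
Proof. exact: sa_hpartD. Qed.

Lemma hpartK b c x : hpart b (hpart c x) = if b == c then hpart c x else 0.
Proof. exact: sa_hpartK. Qed.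

Lemma hpart1 b : hpart b (1 : A) = if b then 0 else 1.
Proof. by rewrite -(sa_hpart1 A) [LHS]hpartK; case: b. Qed.

Lemma hpart_homog b x : homogeneous b (hpart b x).
Proof. by rewrite /homogeneous hpartK eqxx. Qed.

Lemma homogeneousE b c x : homogeneous b x ->
  hpart c x = if c == b then x else 0.
Proof. by move=> h; rewrite -h hpartK h. Qed.

Lemma homogeneousM b c x y : homogeneous b x -> homogeneous c y ->
  homogeneous (b (+) c) (x * y).
Proof. by move=> h1 h2; rewrite /homogeneous -h1 -h2; apply: sa_hpartM. Qed.

Lemma hpartM b x y : hpart b (x * y) =
  hpart false x * hpart b y + hpart true x * hpart (~~ b) y.
Proof.
rewrite -{1}[x]hpartD -{1}[y]hpartD mulrDl !mulrDr !raddfD /=.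
rewrite !(homogeneousE _ (homogeneousM (hpart_homog _ _) (hpart_homog _ _))).
by case: b => /=; rewrite ?addr0 ?add0r // addrC.
Qed.

End SuperTheory.

(* The free superalgebra on generators x : X of parity par x: the algebra of   *)
(* the free monoid on X.                                                       *)

Section FreeSuper.
Variables (K : comNzRingType) (X : choiceType) (par : X -> bool).
Local Notation F := {malg K[{fmonom X}]}.

Definition word_parity (w : {fmonom X}) : bool :=
  foldr (fun x b => par x (+) b) false (fmonom_val w).

Definition free_hpart (b : bool) (g : F) : F :=
  [malg w in msupp g => if word_parity w == b then g@_w else 0].

Lemma free_hpartE b g w :
  (free_hpart b g)@_w = if word_parity w == b then g@_w else 0.
Proof.
by rewrite mcoeffE; case: ifP => // /negbT /mcoeff_outdom ->; rewrite if_same.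
Qed.

Lemma free_scalerAr (k : K) (x y : F) : k *: (x * y) = x * (k *: y).
Proof.
have zU (l m : K) (w : {fmonom X}) : l *: << m *g w >> = << l * m *g w >> :> F.
  by apply/malgP => v; rewrite mcoeffZ !mcoeffU mulrnAr.
rewrite [y]monalgE mulr_sumr !scaler_sumr mulr_sumr; apply: eq_bigr => v _.
rewrite [x]monalgE !mulr_suml scaler_sumr; apply: eq_bigr => w _.
by rewrite zU !malgM_def !fgmulUU zU mulrCA.
Qed.

Lemma free_hpartP b (k : K) (x y : F) :
  free_hpart b (k *: x + y) = k *: free_hpart b x + free_hpart b y.
Proof.
apply/malgP => w; rewrite !(free_hpartE, mcoeffD, mcoeffZ).
by case: ifP; rewrite ?mulr0 ?addr0.
Qed.

Lemma free_hpartD (x : F) : free_hpart false x + free_hpart true x = x.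
Proof.
apply/malgP => w; rewrite mcoeffD !free_hpartE.
by case: (word_parity w); rewrite /= ?addr0 ?add0r.
Qed.

Lemma free_hpartK b c (x : F) :
  free_hpart b (free_hpart c x) = if b == c then free_hpart c x else 0.
Proof.
apply/malgP => w; rewrite (fun_if (mcoeff w)) mcoeff0 !free_hpartE.
by case: b c (word_parity w) => [] [] [].
Qed.

Lemma word_parityM (v w : {fmonom X}) :
  word_parity (mmul v w) = word_parity v (+) word_parity w.
Proof.
rewrite /word_parity /mmul /= fmmulE /=; elim: (fmonom_val v) => //= x s ->.
by rewrite addbA.
Qed.

Lemma free_hpart1 : free_hpart false (1 : F) = 1.
Proof.
apply/malgP => w; rewrite free_hpartE mcoeff1; case: (w =P _) => [->|_].
  by rewrite /word_parity fm1.
by rewrite if_same.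
Qed.

Lemma free_hpartU b (k : K) (w : {fmonom X}) :
  free_hpart b << k *g w >> = if word_parity w == b then << k *g w >> else 0.
Proof.
apply/malgP => v; rewrite (fun_if (mcoeff v)) mcoeff0 !free_hpartE !mcoeffU.
by case: (w =P v) => [->|_]; rewrite ?mulr0n ?if_same //.
Qed.

Lemma free_hpartM b c (x y : F) :
  free_hpart (b (+) c) (free_hpart b x * free_hpart c y) =
  free_hpart b x * free_hpart c y.
Proof.
have hz e : free_hpart e 0 = 0.
  by apply/malgP => w; rewrite free_hpartE mcoeff0 if_same.
have hD e : {morph free_hpart e : u v / u + v}.
  by move=> u v; rewrite -[u in LHS]scale1r free_hpartP scale1r.
have hS e (r : seq {fmonom X}) (G : {fmonom X} -> F) :
    free_hpart e (\sum_(w <- r) G w) = \sum_(w <- r) free_hpart e (G w).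
  exact: (big_morph _ (hD e) (hz e)).
rewrite [x]monalgE [y]monalgE (hS b) (hS c) !mulr_suml (hS (b (+) c)).
apply: eq_bigr => v _; rewrite !mulr_sumr hS; apply: eq_bigr => w _.
rewrite !free_hpartU; case: eqP => [<-|_]; last by rewrite mul0r hz.
case: eqP => [<-|_]; last by rewrite mulr0 hz.
by rewrite malgM_def fgmulUU free_hpartU word_parityM eqxx.
Qed.

Definition free_super : superAlgType K :=
  @SuperAlg K F *:%R (@scalerA K F) (@scale1r K F) (@scalerDr K F)
    (fun x k l => scalerDl x k l) (@scalerAl K F) free_scalerAr free_hpart free_hpartP
    free_hpartD free_hpartK free_hpart1 free_hpartM.

Definition free_gen (x : X) : free_super := << fmu x >> : F.

End FreeSuper.

(* The quotient of a superalgebra by the two-sided graded ideal generated by S *)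
(* (graded: the homogeneous components of the elements of S are killed too;    *)
(* this changes nothing when S consists of homogeneous elements).              *)

Section Quotient.
Variables (K : comNzRingType) (A : superAlgType K) (S : A -> Prop).

Record super_ideal (I : A -> Prop) : Prop := SuperIdeal {
  super_ideal0 : I 0;
  super_idealB : forall x y, I x -> I y -> I (x - y);
  super_idealMl : forall x y, I y -> I (x * y);
  super_idealMr : forall x y, I x -> I (x * y);
  super_ideal_hpart : forall b x, I x -> I (hpart b x) }.

Definition ideal_gen (x : A) : Prop :=
  forall I : A -> Prop, super_ideal I -> (forall s, S s -> I s) -> I x.

Lemma ideal_genP : super_ideal ideal_gen.
Proof.
split=> [I i|x y hx hy I i h|x y hy I i h|x y hx I i h|b x hx I i h].
- by move=> _; apply: super_ideal0.
- by apply: super_idealB => //; [apply: hx|apply: hy].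
- by apply: super_idealMl => //; apply: hy.
- by apply: super_idealMr => //; apply: hx.
- by apply: super_ideal_hpart => //; apply: hx.
Qed.

Let igB := super_idealB ideal_genP.
Let ig0 := super_ideal0 ideal_genP.

Lemma ideal_genN x : ideal_gen x -> ideal_gen (- x).
Proof. by move=> h; rewrite -sub0r; apply: igB. Qed.

Lemma ideal_genD x y : ideal_gen x -> ideal_gen y -> ideal_gen (x + y).
Proof. by move=> hx hy; rewrite -[y]opprK; apply: igB => //; apply: ideal_genN. Qed.

Lemma ideal_genZ (k : K) x : ideal_gen x -> ideal_gen (k *: x).
Proof.
by move=> h; rewrite -[x]mul1r super_scalerAl; apply: (super_idealMl ideal_genP).
Qed.

Definition quot_rel (x y : A) : bool := `[< ideal_gen (x - y) >].

Lemma quot_rel_equiv : equiv_class_of quot_rel.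
Proof.
split=> [x|x y|y x z].
- by apply/asboolP; rewrite subrr.
- by apply/asboolP/asboolP => /ideal_genN; rewrite opprB.
- move=> /asboolP h1 /asboolP h2; apply/asboolP.
  by rewrite -(subrKA y); apply: ideal_genD.
Qed.

Canonical quot_equiv := EquivRelPack quot_rel_equiv.

Definition quot_sort := {eq_quot quot_rel}.
HB.instance Definition _ := Choice.on quot_sort.

Definition quot_pi (x : A) : quot_sort := \pi_({eq_quot quot_rel}) x.

Lemma quot_piP x y : quot_pi x = quot_pi y <-> ideal_gen (x - y).
Proof.
split=> [/eqmodP|h]; first by move=> /asboolP.
by apply/eqmodP/asboolP.
Qed.

Lemma quot_pi_surj (u : quot_sort) : exists x, u = quot_pi x.
Proof. by exists (repr u); rewrite /quot_pi reprK. Qed.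

Lemma quot_reprP x : ideal_gen (repr (quot_pi x) - x).
Proof. by apply/quot_piP; rewrite /quot_pi reprK. Qed.

Definition quot_add (u v : quot_sort) := quot_pi (repr u + repr v).
Definition quot_opp (u : quot_sort) := quot_pi (- repr u).
Definition quot_mul (u v : quot_sort) := quot_pi (repr u * repr v).
Definition quot_scale (k : K) (u : quot_sort) := quot_pi (k *: repr u).
Definition quot_hpart (b : bool) (u : quot_sort) := quot_pi (hpart b (repr u)).

Lemma quot_piD x y : quot_add (quot_pi x) (quot_pi y) = quot_pi (x + y).
Proof.
by apply/quot_piP; rewrite opprD addrACA; apply: ideal_genD; apply: quot_reprP.
Qed.

Lemma quot_piN x : quot_opp (quot_pi x) = quot_pi (- x).
Proof.
by apply/quot_piP; rewrite -opprD; apply: ideal_genN; apply: quot_reprP.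
Qed.

Lemma quot_piM x y : quot_mul (quot_pi x) (quot_pi y) = quot_pi (x * y).
Proof.
apply/quot_piP; rewrite -(subrKA (x * repr (quot_pi y))) -mulrBl -mulrBr.
by apply: ideal_genD; [apply: (super_idealMr ideal_genP)
  |apply: (super_idealMl ideal_genP)]; apply: quot_reprP.
Qed.

Lemma quot_piZ k x : quot_scale k (quot_pi x) = quot_pi (k *: x).
Proof.
by apply/quot_piP; rewrite -scalerBr; apply: ideal_genZ; apply: quot_reprP.
Qed.

Lemma quot_pi_hpart b x : quot_hpart b (quot_pi x) = quot_pi (hpart b x).
Proof.
apply/quot_piP; rewrite -raddfB; apply: (super_ideal_hpart ideal_genP).
exact: quot_reprP.
Qed.

Let qE := (quot_piD, quot_piN, quot_piM, quot_piZ, quot_pi_hpart).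

Lemma quot_addA : associative quot_add.
Proof.
move=> u v w; have [[[x ->] [y ->]] [z ->]] :=
  (quot_pi_surj u, quot_pi_surj v, quot_pi_surj w).
by rewrite !qE addrA.
Qed.

Lemma quot_addC : commutative quot_add.
Proof.
move=> u v; have [[x ->] [y ->]] := (quot_pi_surj u, quot_pi_surj v).
by rewrite !qE addrC.
Qed.

Lemma quot_add0 : left_id (quot_pi 0) quot_add.
Proof. by move=> u; have [x ->] := quot_pi_surj u; rewrite !qE add0r. Qed.

Lemma quot_addN : left_inverse (quot_pi 0) quot_opp quot_add.
Proof. by move=> u; have [x ->] := quot_pi_surj u; rewrite !qE addNr. Qed.

HB.instance Definition _ :=
  GRing.isZmodule.Build quot_sort quot_addA quot_addC quot_add0 quot_addN.

Lemma quot_mulA : associative quot_mul.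
Proof.
move=> u v w; have [[[x ->] [y ->]] [z ->]] :=
  (quot_pi_surj u, quot_pi_surj v, quot_pi_surj w).
by rewrite !qE mulrA.
Qed.

Lemma quot_mul1l : left_id (quot_pi 1) quot_mul.
Proof. by move=> u; have [x ->] := quot_pi_surj u; rewrite !qE mul1r. Qed.

Lemma quot_mul1r : right_id (quot_pi 1) quot_mul.
Proof. by move=> u; have [x ->] := quot_pi_surj u; rewrite !qE mulr1. Qed.

Lemma quot_mulDl : left_distributive quot_mul quot_add.
Proof.
move=> u v w; have [[[x ->] [y ->]] [z ->]] :=
  (quot_pi_surj u, quot_pi_surj v, quot_pi_surj w).
by rewrite !qE mulrDl.
Qed.

Lemma quot_mulDr : right_distributive quot_mul quot_add.
Proof.
move=> u v w; have [[[x ->] [y ->]] [z ->]] :=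
  (quot_pi_surj u, quot_pi_surj v, quot_pi_surj w).
by rewrite !qE mulrDr.
Qed.

HB.instance Definition _ := GRing.Zmodule_isPzRing.Build quot_sort
  quot_mulA quot_mul1l quot_mul1r quot_mulDl quot_mulDr.

Fact quot_scaleA k l u : quot_scale k (quot_scale l u) = quot_scale (k * l) u.
Proof. by have [x ->] := quot_pi_surj u; rewrite !qE scalerA. Qed.

Fact quot_scale1 : left_id 1 quot_scale.
Proof. by move=> u; have [x ->] := quot_pi_surj u; rewrite !qE scale1r. Qed.

Fact quot_scaleDr : right_distributive quot_scale +%R.
Proof.
move=> k u v; have [[x ->] [y ->]] := (quot_pi_surj u, quot_pi_surj v).
by rewrite -[_ + _]/(quot_add _ _) !qE scalerDr -[RHS]/(quot_add _ _) !qE.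
Qed.

Fact quot_scaleDl u : {morph quot_scale^~ u : k l / k + l}.
Proof.
move=> k l; have [x ->] := quot_pi_surj u.
by rewrite -[RHS]/(quot_add _ _) !qE scalerDl.
Qed.

Fact quot_scaleAl k (u v : quot_sort) :
  quot_scale k (u * v) = quot_scale k u * v.
Proof.
have [[x ->] [y ->]] := (quot_pi_surj u, quot_pi_surj v).
by rewrite -[_ * _]/(quot_mul _ _) -[RHS]/(quot_mul _ _) !qE super_scalerAl.
Qed.

Fact quot_scaleAr k (u v : quot_sort) :
  quot_scale k (u * v) = u * quot_scale k v.
Proof.
have [[x ->] [y ->]] := (quot_pi_surj u, quot_pi_surj v).
by rewrite -[_ * _]/(quot_mul _ _) -[RHS]/(quot_mul _ _) !qE super_scalerAr.
Qed.

Fact quot_hpartP b k (u v : quot_sort) :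
  quot_hpart b (quot_scale k u + v) =
  quot_scale k (quot_hpart b u) + quot_hpart b v.
Proof.
have [[x ->] [y ->]] := (quot_pi_surj u, quot_pi_surj v).
by rewrite -[_ + _]/(quot_add _ _) -[RHS]/(quot_add _ _) !qE linearP.
Qed.

Fact quot_hpartD (u : quot_sort) : quot_hpart false u + quot_hpart true u = u.
Proof.
by have [x ->] := quot_pi_surj u; rewrite -[LHS]/(quot_add _ _) !qE hpartD.
Qed.

Fact quot_hpartK b c u :
  quot_hpart b (quot_hpart c u) = if b == c then quot_hpart c u else 0.
Proof.
by have [x ->] := quot_pi_surj u; rewrite !qE hpartK; case: ifP.
Qed.

Fact quot_hpart1 : quot_hpart false 1 = 1.
Proof. by rewrite -[1]/(quot_pi 1) qE hpart1. Qed.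

Fact quot_hpartM b c (u v : quot_sort) :
  quot_hpart (b (+) c) (quot_hpart b u * quot_hpart c v) =
  quot_hpart b u * quot_hpart c v.
Proof.
have [[x ->] [y ->]] := (quot_pi_surj u, quot_pi_surj v).
rewrite -[_ * _]/(quot_mul _ _) !qE.
by rewrite (homogeneousM (hpart_homog _ _) (hpart_homog _ _)).
Qed.

Definition super_quot : superAlgType K :=
  SuperAlg quot_scaleA quot_scale1 quot_scaleDr quot_scaleDl quot_scaleAl
    quot_scaleAr quot_hpartP quot_hpartD quot_hpartK quot_hpart1 quot_hpartM.

Definition super_pi (x : A) : super_quot := quot_pi x.

Lemma super_piP x y : super_pi x = super_pi y <-> ideal_gen (x - y).
Proof. exact: quot_piP. Qed.

Lemma super_pi_surj (u : super_quot) : exists x, u = super_pi x.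
Proof. exact: quot_pi_surj. Qed.

Lemma super_pi_morphism : super_morphism super_pi.
Proof.
split=> [k x y|//|b x]; last by rewrite /super_pi -quot_pi_hpart.
  by rewrite /super_pi -quot_piD -quot_piZ.
by split=> [//|x y]; rewrite /super_pi -quot_piM.
Qed.

End Quotient.

(* The tensor product over K of two superalgebras: finite formal sums of pairs *)
(* (a, b), identified when all K-bilinear maps agree on them, with the product *)
(* (a \ox b) * (a' \ox b') = (-1)^(|b||a'|) (a a') \ox (b b'), see tensM.      *)

Definition bilin (K : comNzRingType) (U V M : lmodType K) (f : U -> V -> M) :=
  (forall v, linear (f^~ v)) /\ (forall u, linear (f u)).

Section Tensor.
Variables (K : comNzRingType) (A B : superAlgType K).
Implicit Types (l : seq (A * B)) (p : A * B).

Definition tens_eval (M : lmodType K) (f : A -> B -> M) l : M :=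
  \sum_(p <- l) f p.1 p.2.

Definition tens_rel l l' : bool :=
  `[< forall (M : lmodType K) (f : A -> B -> M), bilin f ->
      tens_eval f l = tens_eval f l' >].

Lemma tens_rel_equiv : equiv_class_of tens_rel.
Proof.
split=> [l|l l'|l2 l1 l3]; first by apply/asboolP.
- by apply/asboolP/asboolP => h M f hf; rewrite h.
- by move=> /asboolP h1 /asboolP h2; apply/asboolP => M f hf; rewrite h1 ?h2.
Qed.

Canonical tens_equiv := EquivRelPack tens_rel_equiv.

Definition tens_sort := {eq_quot tens_rel}.
HB.instance Definition _ := Choice.on tens_sort.

Definition tens_pi l : tens_sort := \pi_({eq_quot tens_rel}) l.

Lemma tens_piP l l' : tens_pi l = tens_pi l' <->
  forall (M : lmodType K) (f : A -> B -> M), bilin f ->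
    tens_eval f l = tens_eval f l'.
Proof.
split=> [/eqmodP /asboolP //|h].
by apply/eqmodP/asboolP.
Qed.

Lemma tens_pi_surj (u : tens_sort) : exists l, u = tens_pi l.
Proof. by exists (repr u); rewrite /tens_pi reprK. Qed.

Lemma tens_reprP l (M : lmodType K) (f : A -> B -> M) : bilin f ->
  tens_eval f (repr (tens_pi l)) = tens_eval f l.
Proof. by move: M f; apply/tens_piP; rewrite /tens_pi reprK. Qed.

Definition tens_scale_seq (k : K) l := [seq (k *: p.1, p.2) | p <- l].

Definition tens_mul_pair p p' : seq (A * B) :=
  [seq ((-1) ^+ (c && d) *: (p.1 * hpart d p'.1), hpart c p.2 * p'.2)
    | c <- [:: false; true], d <- [:: false; true]].

Definition tens_mul_seq l l' :=
  flatten [seq tens_mul_pair p p' | p <- l, p' <- l'].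

Definition tens_hpart_seq (b : bool) l :=
  flatten [seq [seq (hpart c p.1, hpart (c (+) b) p.2) | c <- [:: false; true]]
    | p <- l].

Definition tens_add (u v : tens_sort) := tens_pi (repr u ++ repr v).
Definition tens_scale (k : K) (u : tens_sort) :=
  tens_pi (tens_scale_seq k (repr u)).
Definition tens_mul (u v : tens_sort) := tens_pi (tens_mul_seq (repr u) (repr v)).
Definition tens_hpart (b : bool) (u : tens_sort) :=
  tens_pi (tens_hpart_seq b (repr u)).

Section Eval.
Variables (M : lmodType K) (f : A -> B -> M).
Hypothesis hf : bilin f.

Lemma bilinPl k a a' b : f (k *: a + a') b = k *: f a b + f a' b.
Proof. by have [h _] := hf; apply: h. Qed.

Lemma bilinPr k a b b' : f a (k *: b + b') = k *: f a b + f a b'.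
Proof. by have [_ h] := hf; apply: h. Qed.

Lemma bilinDl a a' b : f (a + a') b = f a b + f a' b.
Proof. by have := bilinPl 1 a a' b; rewrite !scale1r. Qed.

Lemma bilinDr a b b' : f a (b + b') = f a b + f a b'.
Proof. by have := bilinPr 1 a b b'; rewrite !scale1r. Qed.

Lemma bilin0l b : f 0 b = 0.
Proof. by apply: (addIr (f 0 b)); rewrite -bilinDl addr0 add0r. Qed.

Lemma bilin0r a : f a 0 = 0.
Proof. by apply: (addIr (f a 0)); rewrite -bilinDr addr0 add0r. Qed.

Lemma bilinZl k a b : f (k *: a) b = k *: f a b.
Proof. by rewrite -[k *: a]addr0 bilinPl bilin0l addr0. Qed.

Lemma bilinZr k a b : f a (k *: b) = k *: f a b.
Proof. by rewrite -[k *: b]addr0 bilinPr bilin0r addr0. Qed.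

Lemma tens_eval_nil : tens_eval f [::] = 0.
Proof. exact: big_nil. Qed.

Lemma tens_eval_seq1 p : tens_eval f [:: p] = f p.1 p.2.
Proof. exact: big_seq1. Qed.

Lemma tens_eval_cat l l' : tens_eval f (l ++ l') = tens_eval f l + tens_eval f l'.
Proof. exact: big_cat. Qed.

Lemma tens_eval_scale k l : tens_eval f (tens_scale_seq k l) = k *: tens_eval f l.
Proof.
rewrite /tens_eval big_map scaler_sumr; apply: eq_bigr => p _ /=.
exact: bilinZl.
Qed.

Definition eval_mul p p' : M :=
  \sum_(q <- tens_mul_pair p p') f q.1 q.2.

Lemma eval_mulE p p' : eval_mul p p' =
  f (p.1 * hpart false p'.1) (hpart false p.2 * p'.2) +
  f (p.1 * hpart true p'.1) (hpart false p.2 * p'.2) +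
  f (p.1 * hpart false p'.1) (hpart true p.2 * p'.2) -
  f (p.1 * hpart true p'.1) (hpart true p.2 * p'.2).
Proof.
rewrite /eval_mul /tens_mul_pair /= !big_cons big_nil /= !expr0 expr1.
by rewrite !scale1r scaleN1r addr0 -scaleN1r bilinZl scaleN1r !addrA.
Qed.

Lemma eval_mul_bilinl p' : bilin (fun a b => eval_mul (a, b) p').
Proof.
split=> [b|a] k x y; rewrite !eval_mulE /= !(scalerBr, scalerDr).
  rewrite !mulrDl -!super_scalerAl !bilinPl opprD.
  by rewrite [LHS](AC ((2*2*2)*2) ((1*3*5*7)*(2*4*6*8))).
rewrite !linearP !mulrDl -!super_scalerAl !bilinPr opprD.
by rewrite [LHS](AC ((2*2*2)*2) ((1*3*5*7)*(2*4*6*8))).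
Qed.

Lemma eval_mul_bilinr p : bilin (fun a b => eval_mul p (a, b)).
Proof.
split=> [b|a] k x y; rewrite !eval_mulE /= !(scalerBr, scalerDr).
  rewrite !linearP !mulrDr -!super_scalerAr !bilinPl opprD.
  by rewrite [LHS](AC ((2*2*2)*2) ((1*3*5*7)*(2*4*6*8))).
rewrite !mulrDr -!super_scalerAr !bilinPr opprD.
by rewrite [LHS](AC ((2*2*2)*2) ((1*3*5*7)*(2*4*6*8))).
Qed.

Lemma tens_eval_mul l l' : tens_eval f (tens_mul_seq l l') =
  \sum_(p <- l) \sum_(p' <- l') eval_mul p p'.
Proof.
by rewrite /tens_eval /tens_mul_seq big_flatten /= big_allpairs_dep.
Qed.

Lemma eval_hpart_bilin b :
  bilin (fun x y => f (hpart false x) (hpart b y) + f (hpart true x) (hpart (~~ b) y)).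
Proof.
by split=> [y|x] k u v; rewrite !linearP ?bilinPl ?bilinPr scalerDr addrACA.
Qed.

Lemma tens_eval_hpart b l : tens_eval f (tens_hpart_seq b l) =
  tens_eval (fun x y => f (hpart false x) (hpart b y) + f (hpart true x) (hpart (~~ b) y)) l.
Proof.
rewrite /tens_eval /tens_hpart_seq big_flatten big_map.
by apply: eq_bigr => p _; rewrite /= !big_cons big_nil /= addr0.
Qed.

End Eval.

Lemma tens_eval_pair (M : lmodType K) (g : A * B -> M) l :
  tens_eval (fun a b => g (a, b)) l = \sum_(p <- l) g p.
Proof. by apply: eq_bigr => -[]. Qed.

Lemma tens_piD l l' : tens_add (tens_pi l) (tens_pi l') = tens_pi (l ++ l').
Proof.
by apply/tens_piP => M f hf; rewrite !tens_eval_cat !tens_reprP.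
Qed.

Lemma tens_piZ k l : tens_scale k (tens_pi l) = tens_pi (tens_scale_seq k l).
Proof.
by apply/tens_piP => M f hf; rewrite !tens_eval_scale ?tens_reprP.
Qed.

Lemma tens_piM l l' :
  tens_mul (tens_pi l) (tens_pi l') = tens_pi (tens_mul_seq l l').
Proof.
apply/tens_piP => M f hf; rewrite !tens_eval_mul //.
transitivity (\sum_(p <- repr (tens_pi l)) \sum_(p' <- l') eval_mul f p p').
  apply: eq_bigr => p _; have := tens_reprP l' (eval_mul_bilinr hf p).
  by rewrite !(tens_eval_pair (eval_mul f p)).
rewrite exchange_big [RHS]exchange_big /=; apply: eq_bigr => p' _.
have := tens_reprP l (eval_mul_bilinl hf p').
by rewrite !(tens_eval_pair ((eval_mul f)^~ p')).
Qed.

Lemma tens_pi_hpart b l :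
  tens_hpart b (tens_pi l) = tens_pi (tens_hpart_seq b l).
Proof.
apply/tens_piP => M f hf; rewrite !tens_eval_hpart.
by apply: tens_reprP; apply: eval_hpart_bilin.
Qed.

Let tE := (tens_piD, tens_piZ, tens_piM, tens_pi_hpart).

Lemma tens_addA : associative tens_add.
Proof.
move=> u v w; have [[[l ->] [l' ->]] [l'' ->]] :=
  (tens_pi_surj u, tens_pi_surj v, tens_pi_surj w).
by rewrite !tE catA.
Qed.

Lemma tens_addC : commutative tens_add.
Proof.
move=> u v; have [[l ->] [l' ->]] := (tens_pi_surj u, tens_pi_surj v).
by rewrite !tE; apply/tens_piP => M f hf; rewrite !tens_eval_cat addrC.
Qed.

Lemma tens_add0 : left_id (tens_pi [::]) tens_add.
Proof. by move=> u; have [l ->] := tens_pi_surj u; rewrite !tE. Qed.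

Lemma tens_addN : left_inverse (tens_pi [::]) (tens_scale (-1)) tens_add.
Proof.
move=> u; have [l ->] := tens_pi_surj u; rewrite !tE; apply/tens_piP => M f hf.
by rewrite tens_eval_cat tens_eval_scale // scaleN1r addNr tens_eval_nil.
Qed.

HB.instance Definition _ :=
  GRing.isZmodule.Build tens_sort tens_addA tens_addC tens_add0 tens_addN.

Fact tens_scaleA k m u : tens_scale k (tens_scale m u) = tens_scale (k * m) u.
Proof.
have [l ->] := tens_pi_surj u; rewrite !tE; apply/tens_piP => M f hf.
by rewrite !tens_eval_scale // scalerA.
Qed.

Fact tens_scale1 : left_id 1 tens_scale.
Proof.
move=> u; have [l ->] := tens_pi_surj u; rewrite !tE; apply/tens_piP => M f hf.
by rewrite !tens_eval_scale // scale1r.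
Qed.

Fact tens_scaleDr : right_distributive tens_scale +%R.
Proof.
move=> k u v; have [[l ->] [l' ->]] := (tens_pi_surj u, tens_pi_surj v).
rewrite -[_ + _]/(tens_add _ _) -[RHS]/(tens_add _ _) !tE.
by apply/tens_piP => M f hf; rewrite !(tens_eval_scale, tens_eval_cat) // scalerDr.
Qed.

Fact tens_scaleDl u : {morph tens_scale^~ u : k m / k + m}.
Proof.
move=> k m; have [l ->] := tens_pi_surj u; rewrite -[RHS]/(tens_add _ _) !tE.
by apply/tens_piP => M f hf; rewrite !(tens_eval_scale, tens_eval_cat) // scalerDl.
Qed.

HB.instance Definition _ := GRing.Zmodule_isLmodule.Build K tens_sort
  tens_scaleA tens_scale1 tens_scaleDr tens_scaleDl.

Definition tens_pure (a : A) (b : B) : tens_sort := tens_pi [:: (a, b)].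

Lemma tens_pure_bilin : bilin tens_pure.
Proof.
split=> [b|a] k x y;
  rewrite -[RHS]/(tens_add (tens_scale k (tens_pi _)) (tens_pi _)) !tE;
  apply/tens_piP => M f hf; rewrite tens_eval_cat tens_eval_scale //.
  by rewrite !tens_eval_seq1 /= bilinPl.
by rewrite !tens_eval_seq1 /= bilinPr.
Qed.

Lemma tens_pi_sum l : tens_pi l = \sum_(p <- l) tens_pure p.1 p.2.
Proof.
elim: l => [|[a b] l IH]; first by rewrite big_nil.
by rewrite big_cons -IH -[RHS]/(tens_add _ _) tE.
Qed.

Lemma tens_mulDl : left_distributive tens_mul +%R.
Proof.
move=> u v w; have [[[l ->] [l' ->]] [l'' ->]] :=
  (tens_pi_surj u, tens_pi_surj v, tens_pi_surj w).
rewrite -[_ + _]/(tens_add _ _) -[RHS]/(tens_add _ _) !tE.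
apply/tens_piP => M f hf.
by rewrite !(tens_eval_mul, tens_eval_cat) // big_cat.
Qed.

Lemma tens_mulDr : right_distributive tens_mul +%R.
Proof.
move=> u v w; have [[[l ->] [l' ->]] [l'' ->]] :=
  (tens_pi_surj u, tens_pi_surj v, tens_pi_surj w).
rewrite -[_ + _]/(tens_add _ _) -[RHS]/(tens_add _ _) !tE.
apply/tens_piP => M f hf; rewrite !(tens_eval_mul, tens_eval_cat) //.
by rewrite -big_split; apply: eq_bigr => p _; rewrite big_cat.
Qed.

Fact tens_scaleAl k u v : tens_scale k (tens_mul u v) = tens_mul (tens_scale k u) v.
Proof.
have [[l ->] [l' ->]] := (tens_pi_surj u, tens_pi_surj v); rewrite !tE.
apply/tens_piP => M f hf; rewrite !(tens_eval_mul, tens_eval_scale) //.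
rewrite big_map scaler_sumr; apply: eq_bigr => -[a b] _ /=.
rewrite scaler_sumr; apply: eq_bigr => p' _.
exact: esym (bilinZl (eval_mul_bilinl hf p') k a b).
Qed.

Fact tens_scaleAr k u v : tens_scale k (tens_mul u v) = tens_mul u (tens_scale k v).
Proof.
have [[l ->] [l' ->]] := (tens_pi_surj u, tens_pi_surj v); rewrite !tE.
apply/tens_piP => M f hf; rewrite !(tens_eval_mul, tens_eval_scale) //.
rewrite scaler_sumr; apply: eq_bigr => p _ /=.
rewrite big_map scaler_sumr; apply: eq_bigr => -[a b] _ /=.
exact: esym (bilinZl (eval_mul_bilinr hf p) k a b).
Qed.

Lemma tens_sort_ind (P : tens_sort -> Prop) :
  (forall u v, P u -> P v -> P (u + v)) ->
  (forall b c x y, homogeneous b x -> homogeneous c y -> P (tens_pure x y)) ->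
  forall u, P u.
Proof.
move=> hD hP u; have [l ->] := tens_pi_surj u; rewrite tens_pi_sum.
elim: l => [|[x y] l IH]; rewrite ?big_nil ?big_cons.
  have <- : tens_pure 0 0 = 0 by apply: (bilin0l tens_pure_bilin).
  by apply: (hP false false); rewrite /homogeneous raddf0.
apply: (hD _ _ _ IH) => /=.
rewrite -[x]hpartD -[y]hpartD (bilinDl tens_pure_bilin) !(bilinDr tens_pure_bilin).
by apply: (hD); apply: (hD); apply: hP; apply: hpart_homog.
Qed.

Lemma tens_mul_pure b c x y x' y' : homogeneous b y -> homogeneous c x' ->
  tens_mul (tens_pure x y) (tens_pure x' y') =
  (-1) ^+ (b && c) *: tens_pure (x * x') (y * y').
Proof.
move=> hy hx'; rewrite -[RHS]/(tens_scale _ (tens_pi _)) !tE.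
apply/tens_piP => M f hf; rewrite tens_eval_mul // tens_eval_scale //.
rewrite !big_seq1 tens_eval_seq1 eval_mulE //=.
rewrite !(homogeneousE _ hy) !(homogeneousE _ hx').
by case: b c hy hx' => [] [] _ _ /=;
  rewrite ?(mul0r, mulr0, bilin0l hf, bilin0r hf, add0r, addr0, subr0, oppr0);
  rewrite ?scaleN1r ?scale1r.
Qed.

Lemma tens_hpart_pure b c d x y : homogeneous b x -> homogeneous c y ->
  tens_hpart d (tens_pure x y) = if d == b (+) c then tens_pure x y else 0.
Proof.
move=> hx hy; rewrite tE.
apply: (@etrans _ _ (tens_pi (if d == b (+) c then [:: (x, y)] else [::]))); last first.
  by case: ifP.
apply/tens_piP => M f hf; rewrite tens_eval_hpart tens_eval_seq1 /=.
rewrite !(homogeneousE _ hx) !(homogeneousE _ hy) (fun_if (tens_eval f)).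
rewrite tens_eval_seq1 tens_eval_nil.
by case: b c d hx hy => [] [] [] _ _ /=;
  rewrite ?(bilin0l hf, bilin0r hf, add0r, addr0).
Qed.

Lemma tens_mul0l u : tens_mul 0 u = 0.
Proof.
by apply: (addIr (tens_mul 0 u)); rewrite -tens_mulDl !add0r.
Qed.

Lemma tens_mul0r u : tens_mul u 0 = 0.
Proof.
by apply: (addIr (tens_mul u 0)); rewrite -tens_mulDr !add0r.
Qed.

Lemma tens_mulA : associative tens_mul.
Proof.
move=> u v w.
elim/tens_sort_ind: u => [u u' Hu Hu'|b c x y hx hy].
  by rewrite !tens_mulDl Hu Hu'.
elim/tens_sort_ind: v => [v v' Hv Hv'|b' c' x' y' hx' hy'].
  by rewrite tens_mulDl !tens_mulDr tens_mulDl Hv Hv'.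
elim/tens_sort_ind: w => [w w' Hw Hw'|b'' c'' x'' y'' hx'' hy''].
  by rewrite !tens_mulDr Hw Hw'.
rewrite (tens_mul_pure _ _ hy' hx'') (tens_mul_pure _ _ hy hx').
rewrite -[_ *: tens_pure _ _]/(tens_scale _ _) -tens_scaleAr -tens_scaleAl.
rewrite (tens_mul_pure _ _ hy (homogeneousM hx' hx'')).
rewrite (tens_mul_pure _ _ (homogeneousM hy hy') hx'').
rewrite -[LHS]/(_ *: (_ : tens_sort)) -[RHS]/(_ *: (_ : tens_sort)).
rewrite !scalerA -!signr_addb !mulrA.
by congr ((-1) ^+ nat_of_bool _ *: _); case: c c' b' b'' {hx hy hx' hy' hx'' hy''} => [] [] [] [].
Qed.

Lemma homogeneous1 (C : superAlgType K) : homogeneous false (1 : C).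
Proof. by rewrite /homogeneous hpart1. Qed.

Lemma tens_mul1l : left_id (tens_pure 1 1) tens_mul.
Proof.
elim/tens_sort_ind => [u v Hu Hv|b c x y hx hy]; first by rewrite tens_mulDr Hu Hv.
by rewrite (tens_mul_pure _ _ (homogeneous1 _) hx) scale1r !mul1r.
Qed.

Lemma tens_mul1r : right_id (tens_pure 1 1) tens_mul.
Proof.
elim/tens_sort_ind => [u v Hu Hv|b c x y hx hy]; first by rewrite tens_mulDl Hu Hv.
by rewrite (tens_mul_pure _ _ hy (homogeneous1 _)) andbF scale1r !mulr1.
Qed.

HB.instance Definition _ := GRing.Zmodule_isPzRing.Build tens_sort
  tens_mulA tens_mul1l tens_mul1r tens_mulDl tens_mulDr.

Fact tens_hpartP b k (u v : tens_sort) :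
  tens_hpart b (tens_scale k u + v) =
  tens_scale k (tens_hpart b u) + tens_hpart b v.
Proof.
have [[l ->] [l' ->]] := (tens_pi_surj u, tens_pi_surj v).
rewrite -[_ + _]/(tens_add _ _) -[RHS]/(tens_add _ _) !tE.
apply/tens_piP => M f hf.
have hg := eval_hpart_bilin hf b.
by rewrite !(tens_eval_cat, tens_eval_hpart, tens_eval_scale).
Qed.

Lemma tens_hpart_is_linear b : linear (tens_hpart b).
Proof. by move=> k u v; apply: tens_hpartP. Qed.

HB.instance Definition _ b := GRing.isLinear.Build K tens_sort tens_sort _
  (tens_hpart b) (tens_hpart_is_linear b).

Fact tens_hpartD (u : tens_sort) : tens_hpart false u + tens_hpart true u = u.
Proof.
elim/tens_sort_ind: u => [u v Hu Hv|b c x y hx hy].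
  by rewrite !raddfD /= addrACA Hu Hv.
rewrite !(tens_hpart_pure _ hx hy).
by case: (b (+) c) => /=; rewrite ?addr0 ?add0r.
Qed.

Fact tens_hpartK b c u :
  tens_hpart b (tens_hpart c u) = if b == c then tens_hpart c u else 0.
Proof.
elim/tens_sort_ind: u => [u v Hu Hv|b' c' x y hx hy].
  by rewrite !raddfD /= Hu Hv; case: ifP; rewrite ?addr0.
rewrite (tens_hpart_pure _ hx hy).
case: (c =P _) => [->|_]; last by rewrite raddf0 if_same.
exact: tens_hpart_pure.
Qed.

Fact tens_hpart1 : tens_hpart false 1 = 1.
Proof. exact: (tens_hpart_pure false (homogeneous1 _) (homogeneous1 _)). Qed.

Fact tens_hpartM b c (u v : tens_sort) :
  tens_hpart (b (+) c) (tens_hpart b u * tens_hpart c v) =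
  tens_hpart b u * tens_hpart c v.
Proof.
elim/tens_sort_ind: u => [u u' Hu Hu'|b1 c1 x y hx hy].
  by rewrite !(raddfD, mulrDl) /= Hu Hu'.
elim/tens_sort_ind: v => [v v' Hv Hv'|b2 c2 x' y' hx' hy'].
  by rewrite !(raddfD, mulrDr) /= Hv Hv'.
rewrite (tens_hpart_pure _ hx hy) (tens_hpart_pure _ hx' hy').
case: (b =P _) => [->|_]; last by rewrite mul0r raddf0.
case: (c =P _) => [->|_]; last by rewrite mulr0 raddf0.
rewrite -[_ * _]/(tens_mul _ _) (tens_mul_pure _ _ hy hx') linearZ /=.
rewrite (tens_hpart_pure _ (homogeneousM hx hx') (homogeneousM hy hy')).
by rewrite addbACA eqxx.
Qed.

Definition tens : superAlgType K :=
  SuperAlg tens_scaleA tens_scale1 tens_scaleDr tens_scaleDl tens_scaleAl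
    tens_scaleAr tens_hpartP tens_hpartD tens_hpartK tens_hpart1 tens_hpartM.

Definition tensor (a : A) (b : B) : tens := tens_pure a b.
Local Notation "a \ox b" := (tensor a b) (at level 40, left associativity).

Lemma tensor_bilin : bilin tensor.
Proof. exact: tens_pure_bilin. Qed.

Lemma tensM b c x y x' y' : homogeneous b y -> homogeneous c x' ->
  (x \ox y) * (x' \ox y') = (-1) ^+ (b && c) *: ((x * x') \ox (y * y')).
Proof. exact: tens_mul_pure. Qed.

Lemma tens_ind (P : tens -> Prop) :
  (forall u v, P u -> P v -> P (u + v)) ->
  (forall b c x y, homogeneous b x -> homogeneous c y -> P (x \ox y)) ->
  forall u, P u.
Proof. exact: tens_sort_ind. Qed.

(* The linear map induced by f (meaningful when f is bilinear, see tens_liftE). *)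
Definition tens_lift (M : lmodType K) (f : A -> B -> M) (u : tens) : M :=
  tens_eval f (repr (u : tens_sort)).

Lemma tens_liftE (M : lmodType K) (f : A -> B -> M) : bilin f ->
  forall a b, tens_lift f (a \ox b) = f a b.
Proof.
by move=> hf a b; rewrite /tens_lift tens_reprP // tens_eval_seq1.
Qed.

Lemma tens_lift_linear (M : lmodType K) (f : A -> B -> M) : bilin f ->
  linear (tens_lift f).
Proof.
move=> hf k u v; have [[l ->] [l' ->]] := (tens_pi_surj u, tens_pi_surj v).
rewrite -[_ + _]/(tens_add (tens_scale _ _) _) !tE /tens_lift !tens_reprP //.
by rewrite tens_eval_cat tens_eval_scale.
Qed.

End Tensor.

Notation "a \ox b" := (tensor a b) (at level 40, left associativity) : ring_scope.

Section TensorMaps.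
Variable K : comNzRingType.

Definition tens_map (A A' B B' : superAlgType K) (f : A -> A') (g : B -> B') :
    tens A B -> tens A' B' :=
  tens_lift (fun a b => f a \ox g b).

Definition tens_assoc (A B C : superAlgType K) :
    tens (tens A B) C -> tens A (tens B C) :=
  tens_lift (fun u c => tens_lift (fun a b => a \ox (b \ox c)) u).

End TensorMaps.

(* The K-subalgebra generated by S, made graded by closing under homogeneous   *)
(* components; by sub_gen_homog this is the plain subalgebra generated by S    *)
(* when the elements of S are homogeneous.                                     *)

Section SubSuper.
Variables (K : comNzRingType) (A : superAlgType K).

Record subalgebra (V : A -> Prop) : Prop := Subalgebra {
  subalgebra1 : V 1;
  subalgebraP : forall (k : K) x y, V x -> V y -> V (k *: x + y);
  subalgebraM : forall x y, V x -> V y -> V (x * y) }.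

Variable S : A -> Prop.

Definition sub_gen (x : A) : Prop :=
  forall V : A -> Prop, subalgebra V ->
    (forall b y, V y -> V (hpart b y)) -> (forall s, S s -> V s) -> V x.

Lemma sub_genP : subalgebra sub_gen.
Proof.
split=> [V hV _ _|k x y hx hy V hV h1 h2|x y hx hy V hV h1 h2].
- exact: subalgebra1.
- by apply: subalgebraP => //; [apply: hx|apply: hy].
- by apply: subalgebraM => //; [apply: hx|apply: hy].
Qed.

Lemma sub_gen_hpart b x : sub_gen x -> sub_gen (hpart b x).
Proof. by move=> hx V hV h1 h2; apply: (h1 _ _); apply: hx. Qed.

Lemma sub_gen_mem s : S s -> sub_gen s.
Proof. by move=> hs V _ _; apply. Qed.

Lemma sub_gen_homog : (forall s, S s -> exists b, homogeneous b s) ->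
  forall x, sub_gen x <->
    (forall V : A -> Prop, subalgebra V -> (forall s, S s -> V s) -> V x).
Proof.
move=> hS x; split=> [hx V hV hSV|hx V hV _ hSV]; last exact: hx.
have V0 : V 0.
  by rewrite -(addNr (1 : A)) -scaleN1r; apply: subalgebraP => //;
    apply: subalgebra1.
have VD y z : V y -> V z -> V (y + z).
  by move=> hy hz; rewrite -[y]scale1r; apply: subalgebraP.
pose W y := V y /\ forall b, V (hpart b y).
suff [_ h] : W x by rewrite -(hpartD x); apply: VD.
apply: (hx W) => [|b y [hy hyb]|s hs].
- split=> [|k y z [hy hyb] [hz hzb]|y z [hy hyb] [hz hzb]].
  + split=> [|b]; first exact: subalgebra1.
    by rewrite hpart1; case: b => //; apply: subalgebra1.
  + split=> [|b]; first exact: subalgebraP.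
    by rewrite linearP; apply: subalgebraP => //=.
  + split=> [|b]; first exact: subalgebraM.
    by rewrite hpartM; apply: (VD); apply: subalgebraM => //=.
- by split=> // c; rewrite hpartK; case: ifP.
- split=> [|c]; first exact: hSV.
  by have [b /homogeneousE ->] := hS s hs; case: ifP => // _; apply: hSV.
Qed.

Definition sub_pred : {pred A} := fun x => `[< sub_gen x >].

Lemma sub_pred_subring : subring_closed sub_pred.
Proof.
split=> [|x y|x y]; first by apply/asboolP; apply: (subalgebra1 sub_genP).
  move=> /asboolP hx /asboolP hy; apply/asboolP.
  by rewrite addrC -scaleN1r; apply: (subalgebraP sub_genP).
move=> /asboolP hx /asboolP hy; apply/asboolP.
exact: (subalgebraM sub_genP).
Qed.

Lemma sub_pred_submod : submod_closed sub_pred.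
Proof.
split=> [|k x y /asboolP hx /asboolP hy].
  by have := sub_pred_subring => -[h1 hB _]; rewrite -(subrr 1); apply: hB.
by apply/asboolP; apply: (subalgebraP sub_genP).
Qed.

HB.instance Definition _ := GRing.isSubringClosed.Build _ sub_pred sub_pred_subring.
HB.instance Definition _ := GRing.isSubmodClosed.Build _ _ sub_pred sub_pred_submod.

Record sub_sort := SubElt { sub_val : A; sub_valP : sub_val \in sub_pred }.

HB.instance Definition _ := [isSub for sub_val].
HB.instance Definition _ := [Choice of sub_sort by <:].
HB.instance Definition _ := 
  GRing.SubChoice_isSubPzRing.Build A sub_pred sub_sort sub_pred_subring.
HB.instance Definition _ := [SubZmodule_isSubLmodule of sub_sort by <:].

Lemma sub_hpart_subproof b (u : sub_sort) : hpart b (sub_val u) \in sub_pred.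
Proof. by apply/asboolP; apply: sub_gen_hpart; apply/asboolP; apply: (sub_valP u). Qed.

Definition sub_hpart b u : sub_sort := SubElt (sub_hpart_subproof b u).

Fact sub_scaleAl (k : K) (x y : sub_sort) : k *: (x * y) = (k *: x) * y.
Proof. by apply: val_inj; apply: super_scalerAl. Qed.

Fact sub_scaleAr (k : K) (x y : sub_sort) : k *: (x * y) = x * (k *: y).
Proof. by apply: val_inj; apply: super_scalerAr. Qed.

Fact sub_hpartP b (k : K) (x y : sub_sort) :
  sub_hpart b (k *: x + y) = k *: sub_hpart b x + sub_hpart b y.
Proof. by apply: val_inj; apply: hpart_is_linear. Qed.

Fact sub_hpartD (x : sub_sort) : sub_hpart false x + sub_hpart true x = x.
Proof. by apply: val_inj; apply: hpartD. Qed.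

Fact sub_hpartK b c (x : sub_sort) :
  sub_hpart b (sub_hpart c x) = if b == c then sub_hpart c x else 0.
Proof. by apply: val_inj; rewrite /= hpartK; case: ifP. Qed.

Fact sub_hpart1 : sub_hpart false 1 = 1.
Proof. by apply: val_inj; apply: (hpart1 _ false). Qed.

Fact sub_hpartM b c (x y : sub_sort) :
  sub_hpart (b (+) c) (sub_hpart b x * sub_hpart c y) =
  sub_hpart b x * sub_hpart c y.
Proof. by apply: val_inj; apply: homogeneousM; apply: hpart_homog. Qed.

Definition sub_super : superAlgType K :=
  @SuperAlg K sub_sort *:%R (@scalerA K sub_sort) (@scale1r K sub_sort)
    (@scalerDr K sub_sort) (fun x k l => scalerDl x k l) sub_scaleAl
    sub_scaleAr sub_hpart sub_hpartP sub_hpartD sub_hpartK sub_hpart1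
    sub_hpartM.

Definition sub_incl (u : sub_super) : A := sub_val (u : sub_sort).

Definition sub_elt (s : A) (hs : S s) : sub_super :=
  SubElt (asboolT (sub_gen_mem hs)).

Lemma sub_incl_inj : injective sub_incl.
Proof. exact: val_inj. Qed.

Lemma sub_incl_morphism : super_morphism sub_incl.
Proof. by split. Qed.

End SubSuper.

(* Hopf superalgebras; a linear map to K is even when it kills the odd part.   *)

Record hopfSuper (K : comNzRingType) (A : superAlgType K) := HopfSuper {
  comul : A -> tens A A;
  counit : A -> K;
  antipode : A -> A;
  comul_morphism : super_morphism comul;
  counit_scalar : scalar counit;
  counit_monoid : monoid_morphism counit;
  counit_even : forall x, counit (hpart true x) = 0;
  antipode_linear : linear antipode;
  antipode_hpart : forall b x, antipode (hpart b x) = hpart b (antipode x);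
  comulA : forall x,
    tens_assoc (tens_map comul id (comul x)) = tens_map id comul (comul x);
  counitl : forall x, tens_lift (fun a b => counit a *: b) (comul x) = x;
  counitr : forall x, tens_lift (fun a b => counit b *: a) (comul x) = x;
  antipodel : forall x,
    tens_lift (fun a b => antipode a * b) (comul x) = counit x *: (1 : A);
  antipoder : forall x,
    tens_lift (fun a b => a * antipode b) (comul x) = counit x *: (1 : A) }.

Record hopf_morphism (K : comNzRingType) (A B : superAlgType K)
    (HA : hopfSuper A) (HB : hopfSuper B) (f : A -> B) : Prop := HopfMorphism {
  hopf_morphism_super : super_morphism f;
  hopf_morphism_comul : forall x, comul HB (f x) = tens_map f f (comul HA x);
  hopf_morphism_counit : forall x, counit HB (f x) = counit HA x;
  hopf_morphism_antipode : forall x, antipode HB (f x) = f (antipode HA x) }.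

(* A left coaction of A on the superalgebra U, by a morphism of superalgebras. *)

Record left_coaction (K : comNzRingType) (A U : superAlgType K)
    (H : hopfSuper A) (rho : U -> tens A U) : Prop := LeftCoaction {
  coaction_morphism : super_morphism rho;
  coactionA : forall u,
    tens_assoc (tens_map (comul H) id (rho u)) = tens_map id rho (rho u);
  coaction_counit : forall u, tens_lift (fun a v => counit H a *: v) (rho u) = u }.

(* Indices 1..5 are shifted to 0..4; par5 is the parity p, and qrow i stands   *)
(* for q^((-1)^(p(i)+1)).  qV is meant to be the inverse of q.                 *)

Section QuantumSL41.
Variables (K : comNzRingType) (q qV : K).

Definition par5 (i : 'I_5) : bool := i == 4 :> nat.
Definition par_gen (ij : 'I_5 * 'I_5) : bool := par5 ij.1 (+) par5 ij.2.
Definition qrow (i : 'I_5) : K := if par5 i then q else qV.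

Local Notation sgn i j k l := ((-1) ^+ (par_gen (i, j) && par_gen (k, l)) : K).

Inductive Mq_rel (A : superAlgType K) (a : 'I_5 -> 'I_5 -> A) : A -> Prop :=
| Mq_odd (i j : 'I_5) : par_gen (i, j) -> Mq_rel a (a i j ^+ 2)
| Mq_row (i j l : 'I_5) : (j < l)%N ->
    Mq_rel a (a i j * a i l - (sgn i j i l * qrow i) *: (a i l * a i j))
| Mq_col (i j k : 'I_5) : (i < k)%N ->
    Mq_rel a (a i j * a k j - (sgn i j k j * qrow j) *: (a k j * a i j))
| Mq_comm (i j k l : 'I_5) : (i < k)%N && (l < j)%N || (k < i)%N && (j < l)%N ->
    Mq_rel a (a i j * a k l - sgn i j k l *: (a k l * a i j))
| Mq_cross (i j k l : 'I_5) : (i < k)%N -> (j < l)%N ->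
    Mq_rel a (a i j * a k l - sgn i j k l *: (a k l * a i j)
              - (sgn i j k j * (qV - q)) *: (a k j * a i l)).

Definition perm_length (s : 'S_4) : nat :=
  #|[set ij : 'I_4 * 'I_4 | (ij.1 < ij.2)%N && (s ij.2 < s ij.1)%N]|.

(* 'I_4 -> 'I_5 is the inclusion of the even indices.                          *)
Definition ev4 (i : 'I_4) : 'I_5 := widen_ord (leqnSn 4) i.
Definition i5 : 'I_5 := ord_max.

(* The product over 'I_4 is taken in increasing order of the index.            *)
Definition qdet4 (A : superAlgType K) (a : 'I_5 -> 'I_5 -> A) : A :=
  \sum_(s : 'S_4) ((- qV) ^+ perm_length s) *: \prod_(i < 4) a (ev4 i) (ev4 (s i)).

(* Generators of GL_q(4|1): inl (i, j) is a_ij, inr false and inr true are     *)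
(* the adjoined inverses of D_1 and of D_2.                                    *)
Definition GLq_gen : choiceType := ('I_5 * 'I_5 + bool)%type.
Definition GLq_par (x : GLq_gen) : bool :=
  if x is inl ij then par_gen ij else false.
Definition GLq_free : superAlgType K := free_super K GLq_par.

Definition free_a (i j : 'I_5) : GLq_free := @free_gen K GLq_gen GLq_par (inl (i, j)).
Definition free_DV (b : bool) : GLq_free := @free_gen K GLq_gen GLq_par (inr b).
Definition free_D (b : bool) : GLq_free :=
  if b then free_a i5 i5 else qdet4 free_a.

Inductive GLq_rel : GLq_free -> Prop :=
| GLq_Mq x : Mq_rel free_a x -> GLq_rel x
| GLq_DVr b : GLq_rel (free_D b * free_DV b - 1)
| GLq_DVl b : GLq_rel (free_DV b * free_D b - 1).

Definition GLq : superAlgType K := super_quot GLq_rel.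
Definition GLq_a (i j : 'I_5) : GLq := super_pi GLq_rel (free_a i j).
Definition GLq_a55V : GLq := super_pi GLq_rel (free_DV true).

Definition GLq_s (i j : 'I_5) : GLq :=
  GLq_a i j - GLq_a i i5 * GLq_a55V * GLq_a i5 j.
Definition Berq : GLq := qdet4 GLq_s * GLq_a55V.

Definition SLq_rel (x : GLq) : Prop := x = Berq - 1.
Definition SLq : superAlgType K := super_quot SLq_rel.
Definition SLq_a (i j : 'I_5) : SLq := super_pi SLq_rel (GLq_a i j).

(* The generators g_13, g_14, g_23, g_24, gamma_15, gamma_25 of the ideal.     *)
Definition Plq_rel (x : SLq) : Prop :=
  exists i j : 'I_5, (i < 2)%N /\ (2 <= j)%N /\ x = SLq_a i j.
Definition Plq : superAlgType K := super_quot Plq_rel.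
Definition Plq_pi (x : SLq) : Plq := super_pi Plq_rel x.
Definition Plq_a (i j : 'I_5) : Plq := Plq_pi (SLq_a i j).

Definition SLq_hopf_spec (H : hopfSuper SLq) : Prop :=
  forall i j : 'I_5,
    comul H (SLq_a i j) = \sum_(k < 5) SLq_a i k \ox SLq_a k j /\
    counit H (SLq_a i j) = (i == j)%:R.

(* lo embeds 'I_2 as the paper's {1,2}, hi embeds it as {3,4}.                 *)
Definition lo (i : 'I_2) : 'I_5 := widen_ord (isT : (2 <= 5)%N) i.
Definition hi (i : 'I_2) : 'I_5 := inord (2 + i).

Definition Plq_x : 'M[Plq]_2 := \matrix_(i, j) Plq_a (lo i) (lo j).
Definition Plq_y : 'M[Plq]_2 := \matrix_(i, j) Plq_a (hi i) (hi j).
Definition Plq_d : Plq := Plq_a i5 i5.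
(* The blocks of rows {3,4} or 5 and columns {1,2}, {3,4} or 5.                *)
Definition Plq_a_hilo : 'M[Plq]_2 := \matrix_(i, j) Plq_a (hi i) (lo j).
Definition Plq_a_5lo : 'rV[Plq]_2 := \row_j Plq_a i5 (lo j).
Definition Plq_a_5hi : 'rV[Plq]_2 := \row_j Plq_a i5 (hi j).
Definition Plq_a_hi5 : 'cV[Plq]_2 := \col_i Plq_a (hi i) i5.

Section BigCell.
Variables (t : 'M[Plq]_2) (ttau : 'rV[Plq]_2).

Inductive big_cell_gen : Plq -> Prop :=
| big_cell_gen_t (i j : 'I_2) : big_cell_gen (t i j)
| big_cell_gen_ttau (j : 'I_2) : big_cell_gen (ttau 0 j).

Definition big_cell : superAlgType K := sub_super big_cell_gen.
Definition cell_incl : big_cell -> Plq := @sub_incl K Plq big_cell_gen.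
Definition cell_t (i j : 'I_2) : big_cell := sub_elt (big_cell_gen_t i j).
Definition cell_ttau (j : 'I_2) : big_cell := sub_elt (big_cell_gen_ttau j).

End BigCell.

End QuantumSL41.

(* C_q = C[q, q^-1], over the complex numbers R[i].                            *)
Definition Cq (R : realType) : comNzRingType := laurent R[i].
Definition Cq_q (R : realType) : Cq R := laurent_q R[i].
Definition Cq_qV (R : realType) : Cq R := laurent_qV R[i].

(* Main.v *)
Require Import Defs.
From mathcomp Require Import all_boot all_order all_algebra perm.
From mathcomp Require Import finmap boolp reals complex monalg zify.

(* The functions on the big cell are the functions on P that are invariant     *)
(* under right translation by the Levi subgroup L (the block diagonal matrices *)
(* with blocks {1,2} and {3,4,5}): they are the entries of C x^-1, where C is  *)
(* the block of rows 3,4,5 and columns 1,2.  Killing C defines an idempotent   *)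
(* Hopf endomorphism phi of O(P), with image O(L), and the Mq relations show   *)
(* that O(P) is spanned by the products u h with u in O(U12) and h in O(L).    *)
(* Hence p |-> \sum p_1 * S (phi p_2) sends u h to eps(h) u: it is a linear    *)
(* retraction of O(P) onto O(U12).  It makes O(P) \ox O(U12) embed into        *)
(* O(P) \ox O(P), with no flatness argument over C[q, q^-1], so the coaction   *)
(* and its axioms are inherited from the comultiplication; the formulas follow *)
(* by multiplying on the right with the invertible matrix Delta(x).            *)

Set Implicit Arguments.
Unset Strict Implicit.
Unset Printing Implicit Defensive.

Import GRing.Theory.
Local Open Scope ring_scope.

(** * Morphisms of superalgebras, free superalgebras and quotients *)

(** Write C for the block of rows 3,4,5 and columns 1,2, L for the diagonal block on 3,4,5, and T =
    C x^-1. The upper right block vanishes, so Delta(x) = (x \ox 1)(1 \ox x) and Delta(C) = (C \ox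
    1)(1 \ox x) + (L \ox 1)(1 \ox C). Multiplying by Delta(x)^-1 gives Delta(T) = T \ox 1 + (L \ox
    1)(1 \ox T)(S(x) \ox 1); factoring the entries of L through eta, tau and xi yields the two
    formulas ([comul_t], [comul_ttau]).

    Since Delta is a morphism, it sends all of O(U12) into the image of O(P) \ox O(U12) in O(P) \ox
    O(P) ([comul_sub_lift]). That this image is a faithful copy follows from a linear retraction
    onto O(U12), and the coaction axioms are then read off inside tensor powers of O(P)
    ([restricted_coaction]).

    The retraction is built from the Levi projection ([block_projection]) and the antipode
    ([hopf_retraction_mul]). It takes values in O(U12) because O(P) is spanned by products of O(U12)
    with the image of the projection. By [prod_span_all] this reduces to moving Levi generators,
    including the inverses of D_1 and D_2, to the right past entries of C ([lower_gen_straighten],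
    [lower_gen_straighten_inv]). *)

Section LinearMaps.
Variables (K : comNzRingType) (U V : lmodType K) (f : U -> V).
Hypothesis f_lin : linear f.

Lemma linD : {morph f : x y / x + y}.
Proof. by move=> x y; rewrite -[x in LHS]scale1r f_lin scale1r. Qed.

Lemma lin0 : f 0 = 0.
Proof. by apply: (addIr (f 0)); rewrite -linD !add0r. Qed.

Lemma linZ k x : f (k *: x) = k *: f x.
Proof. by rewrite -[k *: x]addr0 f_lin lin0 addr0. Qed.

Lemma linB : {morph f : x y / x - y}.
Proof. by move=> x y; rewrite -scaleN1r linD linZ scaleN1r. Qed.

Lemma lin_sum I r (P : pred I) (F : I -> U) :
  f (\sum_(i <- r | P i) F i) = \sum_(i <- r | P i) f (F i).
Proof. exact: (big_morph f linD lin0). Qed.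

End LinearMaps.

Section Morphisms.
Variables (K : comNzRingType) (A B : superAlgType K) (f : A -> B).
Hypothesis f_mor : super_morphism f.

Lemma smor_lin : linear f. Proof. by case: f_mor. Qed.
Lemma smor1 : f 1 = 1. Proof. by case: f_mor => _ []. Qed.
Lemma smorM : {morph f : x y / x * y}. Proof. by case: f_mor => _ []. Qed.

Lemma smor_prod I r (F : I -> A) : f (\prod_(i <- r) F i) = \prod_(i <- r) f (F i).
Proof. exact: (big_morph f smorM smor1). Qed.

Lemma smor_homogeneous b x : homogeneous b x -> homogeneous b (f x).
Proof. by case: f_mor => _ _ fh hx; rewrite /homogeneous -fh hx. Qed.

Lemma super_ideal_ker : super_ideal (fun x => f x = 0).
Proof.
have f0 := lin0 smor_lin.
split=> [//|x y fx fy|x y fy|x y fx|b x fx].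
- by rewrite (linB smor_lin) fx fy subr0.
- by rewrite smorM fy mulr0.
- by rewrite smorM fx mul0r.
- by case: f_mor => _ _ ->; rewrite fx linear0.
Qed.

Lemma subalgebra_preim (V : B -> Prop) : subalgebra V -> subalgebra (V \o f).
Proof.
case=> V1 VP VM; split=> [|k x y|x y] /=; first by rewrite smor1.
  by rewrite smor_lin; apply: VP.
by rewrite smorM; apply: VM.
Qed.

End Morphisms.

Lemma smor_id (K : comNzRingType) (A : superAlgType K) : super_morphism (@id A).
Proof. by split. Qed.

Lemma smor_comp (K : comNzRingType) (A B C : superAlgType K)
    (f : A -> B) (g : B -> C) :
  super_morphism f -> super_morphism g -> super_morphism (g \o f).
Proof.
move=> [fl [f1 fM] fh] [gl [g1 gM] gh]; split=> [k x y|/=|b x /=].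
- by rewrite /= fl gl.
- by split=> [|x y] /=; rewrite ?f1 ?fM.
- by rewrite fh gh.
Qed.

Lemma subalgebra_eq (K : comNzRingType) (A B : superAlgType K) (f g : A -> B) :
  super_morphism f -> super_morphism g -> subalgebra (fun x => f x = g x).
Proof.
move=> fm gm; split=> [|k x y|x y]; rewrite ?(smor1 fm) ?(smor1 gm) //.
  by rewrite (smor_lin fm) (smor_lin gm) => -> ->.
by rewrite (smorM fm) (smorM gm) => -> ->.
Qed.

Lemma subalgebra_sub_gen (K : comNzRingType) (A : superAlgType K) (S V : A -> Prop) :
  (forall s, S s -> exists b, homogeneous b s) -> subalgebra V ->
  (forall s, S s -> V s) -> forall x, sub_gen S x -> V x.
Proof. by move=> Sh Va SV x /(sub_gen_homog Sh); apply. Qed.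

Section LinearToMorphism.
Variables (K : comNzRingType) (A B : superAlgType K) (f : A -> B).
Hypotheses (f_lin : linear f) (f1 : f 1 = 1).

(** Reduces multiplicativity of a linear map to left factors that are generators; [subalgebra_hpart]
    does the same for compatibility with parity. *)
Lemma subalgebra_multiplicative :
  subalgebra (fun x => forall y, f (x * y) = f x * f y).
Proof.
split=> [y|k x z hx hz y|x z hx hz y].
- by rewrite mul1r f1 mul1r.
- by rewrite mulrDl -super_scalerAl !f_lin hx hz mulrDl super_scalerAl.
- by rewrite -mulrA !hx hz mulrA.
Qed.

Lemma subalgebra_hpart : {morph f : x y / x * y} ->
  subalgebra (fun x => forall b, f (hpart b x) = hpart b (f x)).
Proof.
move=> fM; split=> [b|k x y hx hy b|x y hx hy b].
- by rewrite hpart1 f1 hpart1; case: b; rewrite ?(lin0 f_lin).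
- by rewrite linearP /= !f_lin hx hy linearP.
- by rewrite hpartM (linD f_lin) !fM !hx !hy -hpartM.
Qed.

End LinearToMorphism.

Section FreeLift.
Variables (K : comNzRingType) (X : choiceType) (par : X -> bool).
Local Notation F := (free_super K par).

Lemma free_word (w : {fmonom X}) :
  << w >> = \prod_(x <- fmonom_val w) free_gen K par x :> {malg K[{fmonom X}]}.
Proof.
case: w => s /=; elim: s => [|x s IH].
  by rewrite big_nil; congr << _ >>; apply: val_inj; rewrite /= fm1.
rewrite big_cons -IH -[RHS]/(fgmul _ _) fgmulUU mulr1; congr << _ >>.
by apply: val_inj; rewrite /= fmM fmU.
Qed.

Lemma monalgUZ (k : K) (w : {fmonom X}) : << k *g w >> = k *: << w >>.
Proof. by apply/malgP => v; rewrite mcoeffZ !mcoeffU mulr_natr. Qed.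

Lemma free_ind (V : F -> Prop) : subalgebra V ->
  (forall x, V (free_gen K par x)) -> forall g, V g.
Proof.
case=> V1 VP VM Vg.
have V0 : V 0 by rewrite -(addNr (1 : F)) -scaleN1r; apply: VP.
move=> g; rewrite [g](@monalgE {fmonom X} K).
elim/big_rec: _ => [//|w h _ Vh].
rewrite monalgUZ; apply: VP => //; rewrite free_word.
elim/big_rec: _ => [|x u _ Vu]; first exact: V1.
exact: VM.
Qed.

Variables (B : superAlgType K) (f : X -> B).
Hypothesis f_homog : forall x, homogeneous (par x) (f x).

Definition free_lift (g : F) : B :=
  \sum_(w <- msupp (g : {malg K[{fmonom X}]}))
     (g : {malg K[{fmonom X}]})@_w *: \prod_(x <- fmonom_val w) f x.

(** Makes sums over different supports comparable: linearity is checked on a finite set containing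
    both. *)
Lemma free_liftEw (d : {fset {fmonom X}}) (g : {malg K[{fmonom X}]}) :
  (msupp g `<=` d)%fset ->
  free_lift g = \sum_(w <- d) g@_w *: \prod_(x <- fmonom_val w) f x.
Proof.
move=> le; rewrite [LHS](big_fset_incl _ le) => //= x xd /mcoeff_outdom ->.
by rewrite scale0r.
Qed.

Lemma free_liftU (k : K) (w : {fmonom X}) :
  free_lift << k *g w >> = k *: \prod_(x <- fmonom_val w) f x.
Proof. by rewrite (free_liftEw msuppU_le) big_seq_fset1 mcoeffUU. Qed.

Lemma free_lift_gen x : free_lift (free_gen K par x) = f x.
Proof. by rewrite free_liftU scale1r fmU big_seq1. Qed.

Lemma free_lift_linear : linear free_lift.
Proof.
move=> k g1 g2.
pose d := (msupp (g1 : {malg K[{fmonom X}]}) `|` msupp (g2 : {malg K[{fmonom X}]}))%fset.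
have d1 := fsubsetUl _ _ : (msupp (g1 : {malg K[{fmonom X}]}) `<=` d)%fset.
have d2 := fsubsetUr _ _ : (msupp (g2 : {malg K[{fmonom X}]}) `<=` d)%fset.
rewrite (free_liftEw d1) (free_liftEw d2) (@free_liftEw d); last first.
  apply: (fsubset_trans (msuppD_le _ _)); apply: fsetSU; exact: msuppZ_le.
rewrite scaler_sumr -big_split; apply: eq_bigr => w _.
by rewrite mcoeffD mcoeffZ scalerDl scalerA.
Qed.

Lemma free_lift1 : free_lift 1 = 1.
Proof.
rewrite -[1]/(<< mone >> : {malg K[{fmonom X}]}).
by rewrite free_liftU fm1 big_nil scale1r.
Qed.

Lemma free_liftM : {morph free_lift : g h / g * h}.
Proof.
apply: free_ind; first exact: subalgebra_multiplicative free_lift_linear free_lift1.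
move=> x h; rewrite free_lift_gen [h](@monalgE {fmonom X} K) mulr_sumr.
rewrite !(lin_sum free_lift_linear) mulr_sumr; apply: eq_bigr => w _.
rewrite -[_ * << _ *g _ >>]/(fgmul _ _) fgmulUU !free_liftU mul1r.
by rewrite -super_scalerAr fmM fmU big_cons.
Qed.

Lemma free_gen_homogeneous x : homogeneous (par x) (free_gen K par x).
Proof.
rewrite /homogeneous -[hpart _ _]/(free_hpart par _ _) free_hpartU.
by rewrite /word_parity fmU /= addbF eqxx.
Qed.

Lemma free_lift_morphism : super_morphism free_lift.
Proof.
have fl := free_lift_linear.
split=> [//||b x]; first by split; [exact: free_lift1|exact: free_liftM].
move: x b; apply: free_ind => [|x b].
  exact: (subalgebra_hpart fl free_lift1 free_liftM).
rewrite (homogeneousE _ (free_gen_homogeneous x)) free_lift_gen.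
rewrite (homogeneousE _ (f_homog x)).
by case: ifP => _; rewrite ?free_lift_gen ?(lin0 fl).
Qed.

End FreeLift.

Section QuotientLift.
Variables (K : comNzRingType) (A B : superAlgType K) (S : A -> Prop) (f : A -> B).
Hypotheses (f_mor : super_morphism f) (fS : forall s, S s -> f s = 0).

Definition quot_lift (u : super_quot S) : B := f (repr (u : quot_sort S)).

(** The kernel of [f] is a graded two-sided ideal containing [S], hence contains the ideal generated
    by [S]; the representative chosen by [repr] is therefore immaterial. *)
Lemma quot_lift_pi x : quot_lift (super_pi S x) = f x.
Proof.
apply/subr0_eq; rewrite -(linB (smor_lin f_mor)).
exact: (quot_reprP x (super_ideal_ker f_mor) fS).
Qed.

Lemma quot_lift_morphism : super_morphism quot_lift.
Proof.
have pim := super_pi_morphism S.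
split=> [k u v||b u]; last first.
- have [x ->] := super_pi_surj u; case: pim => _ _ <-.
  by rewrite !quot_lift_pi; case: f_mor.
- split=> [|u v]; first by rewrite -(smor1 pim) quot_lift_pi (smor1 f_mor).
  have [[x ->] [y ->]] := (super_pi_surj u, super_pi_surj v).
  by rewrite -(smorM pim) !quot_lift_pi (smorM f_mor).
have [[x ->] [y ->]] := (super_pi_surj u, super_pi_surj v).
by rewrite -(smor_lin pim) !quot_lift_pi (smor_lin f_mor).
Qed.

End QuotientLift.

Lemma quot_relE (K : comNzRingType) (A : superAlgType K) (S : A -> Prop) s :
  S s -> super_pi S s = 0.
Proof.
move=> Ss; rewrite -(lin0 (smor_lin (super_pi_morphism S))); apply/super_piP.
by rewrite subr0 => I _; apply.
Qed.

(** * Maps induced on tensor products *)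

Section TensorMaps.
Variable K : comNzRingType.
Implicit Types A B C : superAlgType K.

Lemma tens_lin_ext A B (M : lmodType K) (f g : tens A B -> M) :
  linear f -> linear g -> (forall x y, f (x \ox y) = g (x \ox y)) -> f =1 g.
Proof.
move=> fl gl fg; apply: tens_ind => [u v hu hv|b c x y _ _]; last exact: fg.
by rewrite (linD fl) (linD gl) hu hv.
Qed.

Lemma tensor1 A B : 1 = 1 \ox 1 :> tens A B. Proof. by []. Qed.

Lemma tensDl A B (p p' : A) (u : B) : (p + p') \ox u = p \ox u + p' \ox u.
Proof. exact: (bilinDl (@tensor_bilin K A B)). Qed.

Lemma tensDr A B (p : A) (u u' : B) : p \ox (u + u') = p \ox u + p \ox u'.
Proof. exact: (bilinDr (@tensor_bilin K A B)). Qed.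

(** The Koszul sign is trivial as soon as one inner factor is even; splitting the other one into
    homogeneous parts removes any parity assumption on it. *)
Lemma tensM_evenr A B (p p' : A) (u u' : B) : homogeneous false p' ->
  (p \ox u) * (p' \ox u') = (p * p') \ox (u * u').
Proof.
move=> hp'; rewrite -[u]hpartD tensDr !mulrDl tensDr.
by rewrite !(tensM _ _ (hpart_homog _ _) hp') !andbF !scale1r.
Qed.

Lemma tensM_evenl A B (p p' : A) (u u' : B) : homogeneous false u ->
  (p \ox u) * (p' \ox u') = (p * p') \ox (u * u').
Proof.
move=> hu; rewrite -[p']hpartD tensDl !mulrDr tensDl.
by rewrite !(tensM _ _ hu (hpart_homog _ _)) !scale1r.
Qed.

Lemma tens0l A B (b : B) : (0 : A) \ox b = 0.
Proof. exact: (bilin0l (@tensor_bilin K A B)). Qed.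
Lemma tens0r A B (a : A) : a \ox (0 : B) = 0.
Proof. exact: (bilin0r (@tensor_bilin K A B)). Qed.
Lemma tens_suml A B I r (P : pred I) (F : I -> A) (b : B) :
  (\sum_(i <- r | P i) F i) \ox b = \sum_(i <- r | P i) (F i \ox b).
Proof. by have [h _] := @tensor_bilin K A B; apply: (lin_sum (h b)). Qed.
Lemma tens_sumr A B I r (P : pred I) (F : I -> B) (a : A) :
  a \ox (\sum_(i <- r | P i) F i) = \sum_(i <- r | P i) (a \ox F i).
Proof. by have [_ h] := @tensor_bilin K A B; apply: (lin_sum (h a)). Qed.

Lemma tens_mapbilin A A' B B' (f : A -> A') (g : B -> B') :
  linear f -> linear g -> bilin (fun a b => f a \ox g b).
Proof.
move=> fl gl; have [hl hr] := @tensor_bilin K A' B'.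
by split=> [b|a] k x y; rewrite ?fl ?gl ?hl ?hr.
Qed.

Lemma tens_mapE A A' B B' (f : A -> A') (g : B -> B') :
  linear f -> linear g -> forall a b, tens_map f g (a \ox b) = f a \ox g b.
Proof. by move=> fl gl; apply/tens_liftE/tens_mapbilin. Qed.

Lemma tens_map_linear A A' B B' (f : A -> A') (g : B -> B') :
  linear f -> linear g -> linear (tens_map f g).
Proof. by move=> fl gl; apply/tens_lift_linear/tens_mapbilin. Qed.

Lemma tens_map_comp A A' A'' B B' B'' (f : A -> A') (f' : A' -> A'')
    (g : B -> B') (g' : B' -> B'') :
  linear f -> linear f' -> linear g -> linear g' ->
  forall u, tens_map f' g' (tens_map f g u) = tens_map (f' \o f) (g' \o g) u.
Proof.
move=> fl fl' gl gl'.
have fl2 : linear (f' \o f) by move=> k x y; rewrite /= fl fl'.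
have gl2 : linear (g' \o g) by move=> k x y; rewrite /= gl gl'.
apply: tens_lin_ext => [k x y||x y]; last by rewrite !tens_mapE.
  by rewrite !tens_map_linear.
exact: tens_map_linear.
Qed.

Lemma tens_map_morphism A A' B B' (f : A -> A') (g : B -> B') :
  super_morphism f -> super_morphism g -> super_morphism (tens_map f g).
Proof.
move=> fm gm; have fl := smor_lin fm; have gl := smor_lin gm.
have hl := tens_map_linear fl gl; split=> // [|b u].
  split=> [|u v]; first by rewrite tensor1 tens_mapE // (smor1 fm) (smor1 gm).
  move: u; apply: tens_ind => [u u' hu hu'|b c x y hx hy].
    by rewrite mulrDl !(linD hl) hu hu' mulrDl.
  move: v; apply: tens_ind => [v v' hv hv'|b' c' x' y' hx' hy'].
    by rewrite mulrDr !(linD hl) hv hv' mulrDr.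
  rewrite (tensM _ _ hy hx') (linZ hl) !tens_mapE //.
  by rewrite (tensM _ _ (smor_homogeneous gm hy) (smor_homogeneous fm hx')) smorM // smorM.
move: u; apply: tens_ind => [u u' hu hu'|c d x y hx hy].
  by rewrite raddfD /= !(linD hl) hu hu' raddfD.
rewrite [hpart b _](tens_hpart_pure _ hx hy) tens_mapE //.
rewrite [RHS](tens_hpart_pure _ (smor_homogeneous fm hx) (smor_homogeneous gm hy)).
by case: ifP => _; rewrite ?(lin0 hl) ?tens_mapE.
Qed.

Lemma tens_assoc_bilin A B C (c : C) :
  bilin (fun (a : A) (b : B) => a \ox (b \ox c)).
Proof.
have [hl hr] := @tensor_bilin K A (tens B C); have [h _] := @tensor_bilin K B C.
by split=> [b|a] k x y; rewrite ?hl // h hr.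
Qed.

Lemma tens_assoc_bilinl A B C : bilin (fun (u : tens A B) (c : C) =>
  tens_lift (fun a b => a \ox (b \ox c)) u).
Proof.
split=> [c|u k c c']; first exact/tens_lift_linear/(@tens_assoc_bilin A B C c).
move: u; apply: tens_ind => [u v hu hv|_ _ a b _ _].
  rewrite !(linD (tens_lift_linear (@tens_assoc_bilin _ _ _ _))) hu hv.
  by rewrite scalerDr addrACA.
rewrite !(tens_liftE (@tens_assoc_bilin _ _ _ _)).
have [_ hr] := @tensor_bilin K A (tens B C); have [_ h] := @tensor_bilin K B C.
by rewrite h hr.
Qed.

Lemma tens_assoc_linear A B C : linear (@tens_assoc K A B C).
Proof. exact/tens_lift_linear/tens_assoc_bilinl. Qed.

Lemma tens_assocE A B C (a : A) (b : B) (c : C) :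
  tens_assoc ((a \ox b) \ox c) = a \ox (b \ox c).
Proof.
rewrite [LHS](tens_liftE (@tens_assoc_bilinl A B C)).
by rewrite (tens_liftE (@tens_assoc_bilin _ _ _ _)).
Qed.

Lemma tens_assoc_mapr A B C C' (g : C -> C') : linear g -> forall u : tens (tens A B) C,
  tens_assoc (tens_map id g u) = tens_map id (tens_map id g) (tens_assoc u).
Proof.
move=> gl; have il (D : superAlgType K) : linear (@id D) by [].
have [al al'] := (@tens_assoc_linear A B C, @tens_assoc_linear A B C').
have [ml ml'] := (tens_map_linear (il (tens A B)) gl, tens_map_linear (il B) gl).
apply: tens_lin_ext => [k x y|k x y|u c].
- by rewrite ml al'.
- by rewrite al (tens_map_linear (il A) ml').
rewrite tens_mapE //; move: u; apply: tens_ind => [u v hu hv|_ _ a b _ _].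
  have [hl _] := @tensor_bilin K (tens A B) C.
  have [hl' _] := @tensor_bilin K (tens A B) C'.
  rewrite !(linD (hl _), linD (hl' _), linD al, linD al') hu hv.
  by rewrite (linD (tens_map_linear (il A) ml')).
by rewrite !tens_assocE !tens_mapE.
Qed.

End TensorMaps.

(** * Restricting the comultiplication to a retract *)

Section RestrictedCoaction.
Variables (K : comNzRingType) (A : superAlgType K) (H : hopfSuper A).
Variables (S : A -> Prop) (r : A -> A).
Hypothesis S_homog : forall s, S s -> exists b, homogeneous b s.
Hypotheses (r_lin : linear r) (r_sub : forall x, sub_gen S (r x)).
Hypothesis r_id : forall x, sub_gen S x -> r x = x.
Local Notation U := (sub_super S).
Local Notation incl := (@sub_incl K A S).

Let incl_lin : linear incl := smor_lin (sub_incl_morphism S).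

Let r' (x : A) : U := SubElt (asboolT (r_sub x)).

Let r'_lin : linear r'.
Proof. by move=> k x y; apply: val_inj; apply: r_lin. Qed.

Lemma sub_inclK : cancel incl r'.
Proof. by move=> u; apply: val_inj; apply: r_id; apply/asboolP/(sub_valP u). Qed.

Let retr_incl B (u : tens B U) : tens_map id r' (tens_map id incl u) = u.
Proof.
have e : r' \o incl =1 id by move=> x; apply: sub_inclK.
have el : linear (r' \o incl) by move=> k x y; rewrite !e.
rewrite tens_map_comp //; move: u; apply: tens_lin_ext => // [|x y].
  exact: tens_map_linear.
by rewrite tens_mapE // e.
Qed.

(** Tensoring preserves the splitting given by [r], whereas a bare inclusion of modules over [K]
    need not stay injective. *)
Lemma tens_incl_inj B : injective (tens_map id incl : tens B U -> tens B A).
Proof. exact: can_inj (@retr_incl B). Qed.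

Hypothesis S_lift : forall s, S s -> exists w, tens_map id incl w = comul H s.

(** Both maps are morphisms, so the elements whose comultiplication lifts form a subalgebra, and the
    generators suffice. *)
Lemma comul_sub_lift u : exists w, tens_map id incl w = comul H (incl u).
Proof.
have im := tens_map_morphism (smor_id A) (sub_incl_morphism S).
have cm := comul_morphism H.
have : sub_gen S (incl u) by apply/asboolP/(sub_valP u).
pose V x := exists w, tens_map id incl w = comul H x.
apply: (subalgebra_sub_gen S_homog (V := V)).
split=> [|k x y [w wE] [v vE]|x y [w wE] [v vE]].
- by exists 1; rewrite (smor1 im) (smor1 cm).
- by exists (k *: w + v); rewrite (smor_lin im) wE vE (smor_lin cm).
- by exists (w * v); rewrite (smorM im) wE vE (smorM cm).
exact: S_lift.
Qed.

(** Retracting the second factor of the comultiplication loses nothing, by [comul_sub_lift]. Each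
    axiom is then the corresponding one for [H], after cancelling an injective map. *)
Lemma restricted_coaction : exists rho : U -> tens A U,
  left_coaction H rho /\
  forall u, tens_map id incl (rho u) = comul H (incl u).
Proof.
have im := tens_map_morphism (smor_id A) (sub_incl_morphism S).
have cm := comul_morphism H; have sm := sub_incl_morphism S.
pose rho u := tens_map id r' (comul H (incl u)).
have rhoE u : tens_map id incl (rho u) = comul H (incl u).
  by have [w wE] := comul_sub_lift u; rewrite /rho -wE retr_incl.
have rho_lin : linear rho.
  move=> k u v; apply: tens_incl_inj; rewrite (smor_lin im) !rhoE.
  by rewrite (smor_lin sm) (smor_lin cm).
exists rho; split=> //; split=> [|u|u].
- split=> // [|b u].
    split=> [|u v]; apply: tens_incl_inj.
      by rewrite rhoE (smor1 im) (smor1 sm) (smor1 cm).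
    by rewrite rhoE (smorM im) !rhoE (smorM sm) (smorM cm).
  apply: tens_incl_inj; have [_ _ ->] := im; rewrite !rhoE.
  by have [_ _ ->] := sm; have [_ _ ->] := cm.
- have cl := smor_lin cm.
  (* Coassociativity is an equation in a triple tensor product, so the splitting is applied to its
     last factor. *)
  have inj2 : injective (tens_map (@id A) (tens_map (@id A) incl)).
    apply: (can_inj (g := tens_map id (tens_map id r'))) => v.
    have e : tens_map id r' \o tens_map id incl =1 @id (tens A U).
      by move=> w; apply: retr_incl.
    have el : linear (tens_map id r' \o tens_map (@id A) incl) by move=> k x y; rewrite !e.
    rewrite tens_map_comp ?(smor_lin im) //; try exact: tens_map_linear.
    move: v; apply: tens_lin_ext => // [|x y]; first exact: tens_map_linear.
    by rewrite tens_mapE // e.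
  apply: inj2; rewrite -tens_assoc_mapr // tens_map_comp //.
  rewrite [RHS]tens_map_comp //; last exact: smor_lin im.
  have -> : tens_map id incl \o rho = comul H \o incl by apply/funext=> v; apply: rhoE.
  rewrite -[RHS](tens_map_comp (f := id) (f' := id)) // rhoE -comulA -rhoE.
  by rewrite [in RHS]tens_map_comp.
- apply: (@sub_incl_inj K A S); rewrite -[RHS](counitl H) -rhoE.
  have bil (B : superAlgType K) : bilin (fun a (v : B) => counit H a *: v).
    have cl := @counit_scalar _ _ H.
    by split=> [v|a] k x y; rewrite ?cl ?scalerDl ?scalerDr !scalerA // mulrC.
  move: (rho u) => v {u}; move: v; apply: tens_lin_ext => [k x y|k x y|a v].
  + by rewrite (tens_lift_linear (bil _)) incl_lin.
  + by rewrite (smor_lin im) (tens_lift_linear (bil _)).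
  + by rewrite tens_mapE // !(tens_liftE (bil _)) (linZ incl_lin).
Qed.

End RestrictedCoaction.

(** * Hopf projections *)

(** Scalars are absorbed by the right factor when [H] is a subalgebra, so closure under sums already
    gives closure under scaling. *)
Inductive prod_span (K : comNzRingType) (A : superAlgType K) (G H : A -> Prop) :
  A -> Prop :=
| prod_spanM g h : G g -> H h -> prod_span G H (g * h)
| prod_spanD x y : prod_span G H x -> prod_span G H y -> prod_span G H (x + y).

Section ProdSpan.
Variables (K : comNzRingType) (A : superAlgType K) (G H : A -> Prop).
Hypothesis H_sub : subalgebra H.

Lemma subalgebraZ k x : H x -> H (k *: x).
Proof.
case: H_sub => H1 HP HM Hx.
have H0 : H 0 by rewrite -(addNr (1 : A)) -scaleN1r; apply: HP.
by rewrite -[_ *: _]addr0; apply: HP.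
Qed.

Lemma prod_spanZ k x : prod_span G H x -> prod_span G H (k *: x).
Proof.
elim=> [g h Gg Hh|y z _ hy _ hz]; last by rewrite scalerDr; apply: prod_spanD.
by rewrite super_scalerAr; apply: prod_spanM => //; apply: subalgebraZ.
Qed.

Lemma prod_spanMr x h : prod_span G H x -> H h -> prod_span G H (x * h).
Proof.
move=> hx Hh; elim: hx => [g h' Gg Hh'|y z _ hy _ hz].
  by rewrite -mulrA; apply: prod_spanM => //; apply: subalgebraM.
by rewrite mulrDl; apply: prod_spanD.
Qed.

Lemma prod_span_id g : G g -> prod_span G H g.
Proof. by move=> Gg; rewrite -[g]mulr1; apply: prod_spanM => //; apply: subalgebra1. Qed.

End ProdSpan.

(** Write U for [sub_gen S]. Once each generator of U can be moved left past [H], so can all of U;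
    then U H U H lies in U H, which is thus a subalgebra containing the generators of [A]. *)
Lemma prod_span_all (K : comNzRingType) (A : superAlgType K) (S H : A -> Prop) :
  (forall s, S s -> exists b, homogeneous b s) -> subalgebra H ->
  (forall h s, H h -> S s -> prod_span (sub_gen S) H (h * s)) ->
  (forall V, subalgebra V -> (forall s, S s -> V s) -> (forall h, H h -> V h) ->
    forall x, V x) ->
  forall x, prod_span (sub_gen S) H x.
Proof.
move=> Sh Hs HS gen.
have Us := sub_genP S; have [H1 HP HM] := Hs; have [U1 UP UM] := Us.
have Wl u x : sub_gen S u -> prod_span (sub_gen S) H x ->
    prod_span (sub_gen S) H (u * x).
  move=> Uu; elim=> [u' h Uu' Hh|y z _ hy _ hz].
    by rewrite mulrA; apply: prod_spanM => //; apply: UM.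
  by rewrite mulrDr; apply: prod_spanD.
have HU u h : sub_gen S u -> H h -> prod_span (sub_gen S) H (h * u).
  move=> Uu; move: u Uu h; apply: (subalgebra_sub_gen Sh) => [|s Ss h Hh]; last exact: HS.
  split=> [h Hh|k x y hx hy h Hh|x y hx hy h Hh].
  - by rewrite mulr1 -[h]mul1r; apply: prod_spanM.
  - rewrite mulrDr -super_scalerAr; apply: prod_spanD; last exact: hy.
    by apply: prod_spanZ => //; apply: hx.
  - rewrite mulrA; elim: (hx h Hh) => [u h' Uu Hh'|v w _ hv _ hw].
      by rewrite -mulrA; apply: Wl => //; apply: hy.
    by rewrite mulrDl; apply: prod_spanD.
apply: gen => [|s Ss|h Hh]; first split=> [|k x y hx hy|x y hx hy].
- exact: prod_span_id.
- by apply: prod_spanD => //; apply: prod_spanZ.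
- elim: hx => [u h Uu Hh|v w _ hv _ hw]; last by rewrite mulrDl; apply: prod_spanD.
  rewrite -mulrA; apply: Wl => //.
  elim: hy => [u' h' Uu' Hh'|v w _ hv _ hw]; last by rewrite mulrDr; apply: prod_spanD.
  by rewrite mulrA; apply: prod_spanMr => //; apply: HU.
- by apply: prod_span_id => //; apply: sub_gen_mem.
- by rewrite -[h]mul1r; apply: prod_spanM.
Qed.

Section HopfProjection.
Variables (K : comNzRingType) (A : superAlgType K) (H : hopfSuper A).
Variables (phi : A -> A) (S : A -> Prop).
Hypotheses (phi_mor : super_morphism phi) (phi_idem : forall x, phi (phi x) = phi x).
Hypothesis phi_comul : forall x, comul H (phi x) = tens_map phi phi (comul H x).
Hypothesis S_homog : forall s, S s -> exists b, homogeneous b s.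

(** For functions on a group, this is right translation by the subgroup onto which [phi]
    restricts. *)
Definition proj_coaction x := tens_map id phi (comul H x).

Hypothesis S_coinv : forall s, S s -> proj_coaction s = s \ox 1.
Hypothesis US : forall x, prod_span (sub_gen S) (fun h => phi h = h) x.

(* Radford's projection onto the coinvariants of [proj_coaction]. *)
Definition hopf_retraction x : A :=
  tens_lift (fun a b : A => a * antipode H b) (proj_coaction x).

Lemma proj_coaction_morphism : super_morphism proj_coaction.
Proof.
apply: (smor_comp (g := tens_map id phi) (comul_morphism H)).
exact: tens_map_morphism (smor_id A) phi_mor.
Qed.

Let phi_lin := smor_lin phi_mor.

Let bil : bilin (fun a b : A => a * antipode H b).
Proof.
split=> [b|a] k x y; first by rewrite mulrDl super_scalerAl.
by rewrite (antipode_linear H) mulrDr super_scalerAr.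
Qed.

Lemma hopf_retraction_linear : linear hopf_retraction.
Proof.
move=> k x y; rewrite /hopf_retraction (smor_lin proj_coaction_morphism).
exact: tens_lift_linear.
Qed.

Lemma proj_coaction_sub x : sub_gen S x -> proj_coaction x = x \ox 1.
Proof.
have pm := proj_coaction_morphism.
have [tl _] := @tensor_bilin K A A.
apply: (subalgebra_sub_gen S_homog (V := fun x => proj_coaction x = x \ox 1)) => //.
split=> [|k u v hu hv|u v hu hv]; first exact: (smor1 pm).
  by rewrite (smor_lin pm) hu hv tl.
by rewrite (smorM pm) hu hv (tensM_evenl _ _ _ (homogeneous1 A)) mulr1.
Qed.

(** Coinvariance turns [u] into u \ox 1, while on [h] the coaction is the full comultiplication; the
    antipode axiom then collapses the sum over [h]. *)
Lemma hopf_retraction_mul u h : sub_gen S u -> phi h = h ->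
  hopf_retraction (u * h) = counit H h *: u.
Proof.
move=> Uu hh; rewrite /hopf_retraction (smorM proj_coaction_morphism) proj_coaction_sub //.
have -> : proj_coaction h = comul H h.
  rewrite /proj_coaction -{1}hh phi_comul tens_map_comp //.
  have -> : phi \o phi = phi by apply/funext=> x; apply: phi_idem.
  by rewrite -[id \o phi]/phi -phi_comul hh.
have lin := tens_lift_linear bil.
have -> (w : tens A A) : tens_lift (fun a b : A => a * antipode H b) ((u \ox 1) * w) =
    u * tens_lift (fun a b : A => a * antipode H b) w.
  move: w; apply: tens_ind => [v w hv hw|b c x y hx hy].
    by rewrite mulrDr !(linD lin) hv hw mulrDr.
  by rewrite (tensM_evenl _ _ _ (homogeneous1 A)) mul1r !(tens_liftE bil) mulrA.
by rewrite antipoder -super_scalerAr mulr1.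
Qed.

Lemma hopf_retraction_id u : sub_gen S u -> hopf_retraction u = u.
Proof.
move=> Uu; rewrite -[u in LHS]mulr1 hopf_retraction_mul // ?(smor1 phi_mor) //.
by have [-> _] := counit_monoid H; rewrite scale1r.
Qed.

Lemma hopf_retraction_sub x : sub_gen S (hopf_retraction x).
Proof.
elim: (US x) => [u h Uu hh|y z _ hy _ hz].
  rewrite hopf_retraction_mul //.
  exact: (subalgebraZ (sub_genP S)).
rewrite (linD hopf_retraction_linear) -[hopf_retraction y]scale1r.
exact: (subalgebraP (sub_genP S)).
Qed.

End HopfProjection.

(** * The universal property of O(P) *)

Lemma perm_lengthE (s : 'S_4) :
  perm_length s = (\sum_(i < 4) \sum_(j < 4) ((i < j) && (s j < s i)))%N.
Proof.
rewrite /perm_length -sum1_card big_mkcond pair_bigA /=.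
by apply: eq_bigr => -[i j] _; rewrite inE /=; case: ifP.
Qed.

(** * The quantum determinant of a block triangular matrix *)

Section BlockDeterminant.
Local Notation o k := (@Ordinal 4 k isT).

(** A permutation preserving {0,1} preserves {2,3} as well, so the images of 0 and 2 determine
    it. *)
Lemma block_perm (s : 'S_4) : (s (o 0) < 2)%N -> (s (o 1) < 2)%N ->
  s = ((if s (o 0) == o 0 then 1 else tperm (o 0) (o 1)) *
       (if s (o 2) == o 2 then 1 else tperm (o 2) (o 3)))%g.
Proof.
move=> h0 h1.
have ne i j : i != j -> (s i != s j :> nat) by rewrite (inj_eq val_inj) (inj_eq perm_inj).
have := (ne (o 0) (o 1) isT, ne (o 0) (o 2) isT, ne (o 0) (o 3) isT).
have := (ne (o 1) (o 2) isT, ne (o 1) (o 3) isT, ne (o 2) (o 3) isT) => {ne}.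
have vE k (i : 'I_4) : (i == k) = (i == k :> nat) by [].
rewrite !vE.
have := (ltn_ord (s (o 0)), ltn_ord (s (o 1)), ltn_ord (s (o 2)), ltn_ord (s (o 3))).
move=> [[[l0 l1] l2] l3] [[n1 n2] n3] [[n4 n5] n6].
by apply/permP => -[[|[|[|[|//]]]] i4]; apply/val_inj;
  rewrite permM (bool_irrelevance i4 isT);
  case: eqP => /= e; case: eqP => /= e'; rewrite !permE /=; move: e e' => /= e e'; lia.
Qed.

Lemma prod_ord4 (A : pzRingType) (F : 'I_4 -> A) :
  \prod_(i < 4) F i = F (o 0) * F (o 1) * (F (o 2) * F (o 3)).
Proof.
rewrite !big_ord_recl big_ord0 mulr1 mulrA.
by congr (F _ * F _ * (F _ * F _)); apply: val_inj.
Qed.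

Lemma sum_ord4 (F : 'I_4 -> nat) :
  (\sum_(i < 4) F i = F (o 0) + F (o 1) + (F (o 2) + F (o 3)))%N.
Proof.
rewrite !big_ord_recl big_ord0 addn0 addnA.
by congr (F _ + F _ + (F _ + F _))%N; apply: val_inj.
Qed.

Section Det.
Variables (K : comNzRingType) (qV : K) (A : superAlgType K) (a : 'I_5 -> 'I_5 -> A).

(** Only the four permutations preserving {0,1} survive; their lengths add over the two blocks, so
    the sum factors. *)
Lemma qdet4_upper0 : (forall i j : 'I_5, (i < 2)%N -> (2 <= j)%N -> a i j = 0) ->
  let g (i j : nat) := a (inord i) (inord j) in
  qdet4 qV a = (g 0 0 * g 1 1 - qV *: (g 0 1 * g 1 0)) *
               (g 2 2 * g 3 3 - qV *: (g 2 3 * g 3 2)).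
Proof.
move=> a0 g.
have aE (i j : 'I_5) : a i j = g i j by rewrite /g !inord_val.
pose t01 := tperm (o 0) (o 1) : 'S_4; pose t23 := tperm (o 2) (o 3) : 'S_4.
have n (s t : 'S_4) i : s i != t i -> s != t by apply: contraNneq => ->.
rewrite /qdet4 (bigD1 (1%g : 'S_4)) //= (bigD1 t01) /=; last first.
  by apply: (n _ _ (o 0)); rewrite !permE.
rewrite (bigD1 t23) /=; last first.
  by apply/andP; split; [apply: (n _ _ (o 2))|apply: (n _ _ (o 0))]; rewrite !permE.
rewrite (bigD1 (t01 * t23)%g) /=; last first.
  apply/andP; split; first apply/andP; first split.
  - by apply: (n _ _ (o 0)); rewrite !permE /= ?permE.
  - by apply: (n _ _ (o 2)); rewrite !permE /= ?permE.
  - by apply: (n _ _ (o 0)); rewrite !permE /= ?permE.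
(* Any other permutation sends row 0 or row 1 to a column where the entry vanishes. *)
rewrite [X in _ + (_ + (_ + (_ + X)))]big1 => [|s]; last first.
  case: (ltnP (s (o 0)) 2) => [h0|h0 _]; last first.
    by rewrite prod_ord4 (a0 (ev4 (o 0))) // ?(mul0r, scaler0).
  case: (ltnP (s (o 1)) 2) => [h1|h1 _]; last first.
    by rewrite prod_ord4 (a0 (ev4 (o 1))) // ?(mul0r, mulr0, scaler0).
  by rewrite (block_perm h0 h1); do 2!case: ifP => _; rewrite ?mulg1 ?mul1g ?eqxx ?andbF.
rewrite !perm_lengthE !sum_ord4 !prod_ord4 !permE /= !permE /=.
rewrite !aE /= !expr0 !scale1r !expr1.
set u := g 0%N 0%N * _; set v := g 0%N 1%N * _.
set w := g 2%N 2%N * _; set z := g 2%N 3%N * _.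
rewrite addr0 -[(_ + _)%N]/2%N -!scaleNr mulrDl !mulrDr.
rewrite -!super_scalerAl -!super_scalerAr scalerA -expr2 -!addrA.
by congr (_ + _); rewrite addrCA.
Qed.

End Det.

End BlockDeterminant.

Lemma qdet4_morph (K : comNzRingType) (qV : K) (A B : superAlgType K) (f : A -> B)
    (a : 'I_5 -> 'I_5 -> A) : super_morphism f ->
  f (qdet4 qV a) = qdet4 qV (fun i j => f (a i j)).
Proof.
move=> fm; rewrite (lin_sum (smor_lin fm)); apply: eq_bigr => s _.
by rewrite (linZ (smor_lin fm)) (smor_prod fm).
Qed.

Section MqRel.
Variables (K : comNzRingType) (q qV : K) (A B : superAlgType K) (f : A -> B).
Hypothesis f_mor : super_morphism f.
Variable a : 'I_5 -> 'I_5 -> A.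

Let fl := smor_lin f_mor.
Let fE := (smorM f_mor, linB fl, linZ fl).

Lemma Mq_rel_morph x : Mq_rel q qV a x -> Mq_rel q qV (fun i j => f (a i j)) (f x).
Proof.
case=> [i j h|i j l h|i j k h|i j k l h|i j k l h h']; rewrite ?expr2 !fE.
- by rewrite -expr2; apply: Mq_odd.
- exact: Mq_row.
- exact: Mq_col.
- exact: Mq_comm.
- exact: Mq_cross.
Qed.

(** This is how the relations imposed on the free superalgebra become equations between the entries
    in O(P). *)
Lemma Mq_rel_lift y : Mq_rel q qV (fun i j => f (a i j)) y ->
  exists2 x, Mq_rel q qV a x & y = f x.
Proof.
case=> [i j h|i j l h|i j k h|i j k l h|i j k l h h'].
- by eexists; [exact: (Mq_odd _ _ a h)|rewrite !expr2 !fE].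
- by eexists; [exact: (Mq_row _ _ a i h)|rewrite !fE].
- by eexists; [exact: (Mq_col _ _ a j h)|rewrite !fE].
- by eexists; [exact: (Mq_comm _ _ a h)|rewrite !fE].
- by eexists; [exact: (Mq_cross _ _ a h h')|rewrite !fE].
Qed.

End MqRel.

Section PlqPresentation.
Variables (K : comNzRingType) (q qV : K).
Local Notation P := (Plq q qV).
Local Notation a := (Plq_a q qV).

Definition Plq_of (x : GLq_free K) : P :=
  Plq_pi (super_pi (@SLq_rel K q qV) (super_pi (@GLq_rel K q qV) x)).

Definition Plq_DV (c : bool) : P := Plq_of (free_DV K c).

Lemma Plq_of_morphism : super_morphism Plq_of.
Proof.
have m1 := super_pi_morphism (@GLq_rel K q qV).
have m2 := super_pi_morphism (@SLq_rel K q qV).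
exact: (smor_comp (smor_comp m1 m2) (super_pi_morphism (@Plq_rel K q qV))).
Qed.

Lemma Plq_pi_morphism : super_morphism (@Plq_pi K q qV).
Proof. exact: super_pi_morphism. Qed.

Lemma Plq_ind (V : P -> Prop) : subalgebra V ->
  (forall i j, V (a i j)) -> (forall c, V (Plq_DV c)) -> forall x, V x.
Proof.
move=> Vs Va VD x; have [x1 ->] := super_pi_surj x.
have [x2 ->] := super_pi_surj x1; have [x3 ->] := super_pi_surj x2.
move: x3; apply: (free_ind (V := V \o Plq_of)) => [|[[i j]|c]].
- exact: subalgebra_preim Plq_of_morphism _ Vs.
- exact: Va.
- exact: VD.
Qed.

Lemma Plq_a_homog i j : homogeneous (par_gen (i, j)) (a i j).
Proof.
apply: (smor_homogeneous Plq_of_morphism).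
exact: (free_gen_homogeneous K GLq_par (inl (i, j))).
Qed.

Lemma Plq_DV_homog c : homogeneous false (Plq_DV c).
Proof.
apply: (smor_homogeneous Plq_of_morphism).
exact: (free_gen_homogeneous K GLq_par (inr c)).
Qed.

Lemma Plq_of_rel x : GLq_rel q qV x -> Plq_of x = 0.
Proof.
move=> xr; rewrite /Plq_of (quot_relE xr).
rewrite (lin0 (smor_lin (super_pi_morphism _))).
exact: (lin0 (smor_lin Plq_pi_morphism)).
Qed.

Lemma Plq_rel0 x : Mq_rel q qV a x -> x = 0.
Proof.
case/(Mq_rel_lift Plq_of_morphism (a := free_a K)) => y yr ->.
exact/Plq_of_rel/GLq_Mq.
Qed.

Lemma Plq_a_upper0 (i j : 'I_5) : (i < 2)%N -> (2 <= j)%N -> a i j = 0.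
Proof. by move=> hi hj; apply: quot_relE; exists i, j. Qed.

Definition Plq_D (c : bool) : P := if c then a i5 i5 else qdet4 qV a.

Let Plq_of_D c : Plq_of (free_D qV c) = Plq_D c.
Proof. by case: c => //=; apply: (qdet4_morph _ _ Plq_of_morphism). Qed.

Lemma Plq_DDV c : Plq_D c * Plq_DV c = 1.
Proof.
have pm := Plq_of_morphism.
rewrite -Plq_of_D -(smorM pm); apply/subr0_eq.
by rewrite -(smor1 pm) -(linB (smor_lin pm)); apply/Plq_of_rel/GLq_DVr.
Qed.

Lemma Plq_DVD c : Plq_DV c * Plq_D c = 1.
Proof.
have pm := Plq_of_morphism.
rewrite -Plq_of_D -(smorM pm); apply/subr0_eq.
by rewrite -(smor1 pm) -(linB (smor_lin pm)); apply/Plq_of_rel/GLq_DVl.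
Qed.

Lemma Plq_Ber :
  qdet4 qV (fun i j => a i j - a i i5 * Plq_DV true * a i5 j) * Plq_DV true = 1.
Proof.
have sm : super_morphism (super_pi (@SLq_rel K q qV)) by exact: super_pi_morphism.
have pm := smor_comp sm Plq_pi_morphism.
have : (@Plq_pi K q qV \o super_pi (@SLq_rel K q qV)) (Berq q qV - 1) = 0.
  have e : super_pi (@SLq_rel K q qV) (Berq q qV - 1) = 0 by exact: quot_relE.
  by rewrite /comp e (lin0 (smor_lin Plq_pi_morphism)).
rewrite (linB (smor_lin pm)) (smor1 pm) => /subr0_eq.
rewrite /Berq (smorM pm) (qdet4_morph _ _ pm) => <-.
have -> // : (fun i j => (@Plq_pi K q qV \o super_pi (@SLq_rel K q qV)) (GLq_s q qV i j)) =
    (fun i j => a i j - a i i5 * Plq_DV true * a i5 j).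
apply/funext => i; apply/funext => j.
by rewrite /GLq_s (linB (smor_lin pm)) !(smorM pm).
Qed.

Section Lift.
Variables (B : superAlgType K) (b : 'I_5 -> 'I_5 -> B) (v : bool -> B).
Hypotheses (b_homog : forall i j, homogeneous (par_gen (i, j)) (b i j))
  (v_homog : forall c, homogeneous false (v c))
  (b_rel : forall x, Mq_rel q qV b x -> x = 0)
  (b_upper0 : forall i j : 'I_5, (i < 2)%N -> (2 <= j)%N -> b i j = 0)
  (bv : forall c : bool, (if c then b i5 i5 else qdet4 qV b) * v c = 1)
  (vb : forall c : bool, v c * (if c then b i5 i5 else qdet4 qV b) = 1)
  (b_Ber : qdet4 qV (fun i j => b i j - b i i5 * v true * b i5 j) * v true = 1).

(** The map defined on the free superalgebra descends through the three successive quotients, one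
    group of hypotheses for each. *)
Lemma Plq_lift : exists f : P -> B,
  [/\ super_morphism f, forall i j, f (a i j) = b i j & forall c, f (Plq_DV c) = v c].
Proof.
pose g (x : GLq_gen) := match x with inl ij => b ij.1 ij.2 | inr c => v c end.
have gh x : homogeneous (GLq_par x) (g x).
  by case: x => [[i j]|c]; [apply: b_homog|apply: v_homog].
pose f0 := free_lift (par := GLq_par) g.
have f0m : super_morphism f0 := free_lift_morphism gh.
have f0a i j : f0 (free_a K i j) = b i j by apply: free_lift_gen.
have f0v c : f0 (free_DV K c) = v c by apply: free_lift_gen.
have f0aE : (fun i j => f0 (free_a K i j)) = b by apply/funext => i; apply/funext => j.
have f0D c : f0 (free_D qV c) = if c then b i5 i5 else qdet4 qV b.
  by case: c => /=; rewrite ?f0a ?(qdet4_morph _ _ f0m) ?f0aE.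
have f0r x : GLq_rel q qV x -> f0 x = 0.
  case=> [y /(Mq_rel_morph f0m)|c|c]; first by rewrite f0aE => /b_rel.
    by rewrite (linB (smor_lin f0m)) (smorM f0m) (smor1 f0m) f0D f0v bv subrr.
  by rewrite (linB (smor_lin f0m)) (smorM f0m) (smor1 f0m) f0D f0v vb subrr.
pose f1 := quot_lift (S := @GLq_rel K q qV) f0.
have f1m : super_morphism f1 := quot_lift_morphism f0m f0r.
have f1E x : f1 (super_pi (@GLq_rel K q qV) x) = f0 x := quot_lift_pi f0m f0r x.
have f1r x : @SLq_rel K q qV x -> f1 x = 0.
  move=> ->; rewrite (linB (smor_lin f1m)) (smor1 f1m) (smorM f1m) (qdet4_morph _ _ f1m).
  rewrite /GLq_a55V f1E f0v; apply/eqP; rewrite subr_eq0 -b_Ber; apply/eqP.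
  congr (qdet4 _ _ * _); apply/funext => i; apply/funext => j.
  by rewrite /GLq_s (linB (smor_lin f1m)) !(smorM f1m) !f1E f0v !f0a.
pose f2 := quot_lift (S := @SLq_rel K q qV) f1.
have f2m : super_morphism f2 := quot_lift_morphism f1m f1r.
have f2E x : f2 (super_pi (@SLq_rel K q qV) x) = f1 x := quot_lift_pi f1m f1r x.
have f2r x : Plq_rel x -> f2 x = 0.
  by case=> i [j [hi [hj ->]]]; rewrite f2E f1E f0a b_upper0.
pose f3 := quot_lift (S := @Plq_rel K q qV) f2.
have f3E x : f3 (super_pi (@Plq_rel K q qV) x) = f2 x := quot_lift_pi f2m f2r x.
exists f3; split=> [|i j|c]; first exact: quot_lift_morphism f2m f2r.
  by rewrite f3E f2E f1E f0a.
by rewrite f3E f2E f1E f0v.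
Qed.

End Lift.

(** Two morphisms that agree on D_1 and D_2 agree on their two-sided inverses. *)
Lemma Plq_morph_ext (B : superAlgType K) (f g : P -> B) :
  super_morphism f -> super_morphism g -> (forall i j, f (a i j) = g (a i j)) -> f =1 g.
Proof.
move=> fm gm fg; apply: Plq_ind => [|//|c]; first exact: subalgebra_eq.
have fgD : f (Plq_D c) = g (Plq_D c).
  case: c => /=; rewrite ?fg // (qdet4_morph _ _ fm) (qdet4_morph _ _ gm).
  by congr (qdet4 _ _); apply/funext => i; apply/funext => j.
rewrite -[LHS]mulr1 -(smor1 gm) -(Plq_DDV c) (smorM gm) -fgD mulrA -(smorM fm).
by rewrite Plq_DVD (smor1 fm) mul1r.
Qed.

End PlqPresentation.

(** * Projection onto the Levi part *)

Section BlockPart.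
Variables (K : comNzRingType) (q qV : K) (A : superAlgType K).
Variable b : 'I_5 -> 'I_5 -> A.
Hypothesis b_upper0 : forall i j : 'I_5, (i < 2)%N -> (2 <= j)%N -> b i j = 0.

(* The other off-diagonal block of [b], indices i < 2 <= j, vanishes already,  *)
(* so only the block of rows 3,4,5 and columns 1,2 of the paper is killed.     *)
Definition block_part (i j : 'I_5) : A := if (1 < i)%N == (1 < j)%N then b i j else 0.

Lemma block_part_diag (i j : 'I_5) : (1 < i)%N = (1 < j)%N -> block_part i j = b i j.
Proof. by rewrite /block_part => ->; rewrite eqxx. Qed.

Lemma block_part_off (i j : 'I_5) : (1 < i)%N != (1 < j)%N -> block_part i j = 0.
Proof. by rewrite /block_part => /negPf ->. Qed.

Lemma block_part_upper0 (i j : 'I_5) : (i < 2)%N -> (2 <= j)%N -> block_part i j = 0.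
Proof. by move=> hi hj; apply: block_part_off; lia. Qed.

(** Relations between two monomials in the same two entries survive killing either entry; only the
    cross relation, with its extra product, needs an argument. *)
Lemma block_part_rel (b_rel : forall x, Mq_rel q qV b x -> x = 0) x :
  Mq_rel q qV block_part x -> x = 0.
Proof.
have z0 := (mul0r, mulr0, scaler0, subrr).
case=> [i j h|i j l h|i j k h|i j k l h|i j k l h h'].
- rewrite /block_part; case: ifP => _; last by rewrite expr2 mul0r.
  exact/b_rel/Mq_odd.
- rewrite /block_part; do 2!case: ifP => _; rewrite ?z0 //.
  exact/b_rel/Mq_row.
- rewrite /block_part; do 2!case: ifP => _; rewrite ?z0 //.
  exact/b_rel/Mq_col.
- rewrite /block_part; do 2!case: ifP => _; rewrite ?z0 //.
  exact/b_rel/Mq_comm.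
- have := b_rel _ (Mq_cross q qV b h h').
  rewrite /block_part.
  case: (boolP (_ == _)) => ij; case: (boolP ((1 < k)%N == _)) => kl.
  (* If (i, l) is off the diagonal blocks here, then i < 2 <= l, so [b i l] was zero already and the
     extra product vanishes before and after killing. *)
  + case: (boolP ((1 < i)%N == (1 < l)%N)) => il.
      by have -> : ((1 < k)%N == (1 < j)%N) by lia.
    by rewrite mulr0 (b_upper0 (i := i) (j := l)) ?mulr0 //; lia.
  (* In this and the two remaining cases, (k, j) and (i, l) cannot both lie in diagonal blocks,
     given i < k and j < l. *)
  + rewrite !z0 => _; case: ifP => kj; last by rewrite !z0.
    by case: ifP => il; rewrite ?z0 //; lia.
  + rewrite !z0 => _; case: ifP => kj; last by rewrite !z0.
    by case: ifP => il; rewrite ?z0 //; lia.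
  + rewrite !z0 => _; case: ifP => kj; last by rewrite !z0.
    by case: ifP => il; rewrite ?z0 //; lia.
Qed.

Lemma qdet4_block_part : qdet4 qV block_part = qdet4 qV b.
Proof.
rewrite !qdet4_upper0 //; last exact: block_part_upper0.
by rewrite !block_part_diag ?inordK.
Qed.

(** In the first two rows the correction vanishes with [b i i5], and the other diagonal block is
    untouched by [block_part]; the determinant sees nothing else. *)
Lemma qdet4_block_part_Schur v :
  qdet4 qV (fun i j => block_part i j - block_part i i5 * v * block_part i5 j) =
  qdet4 qV (fun i j => b i j - b i i5 * v * b i5 j).
Proof.
pose s i j := b i j - b i i5 * v * b i5 j.
have s_upper0 (i j : 'I_5) : (i < 2)%N -> (2 <= j)%N -> s i j = 0.
  by move=> hi hj; rewrite /s !(b_upper0 hi) // !mul0r subrr.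
have i5E : (1 < i5)%N = true by [].
rewrite !qdet4_upper0 => [|//|i j hi hj]; last first.
  by rewrite block_part_upper0 // (block_part_off (j := i5)) ?i5E ?mul0r ?subrr //; lia.
have lo5 (i : nat) : (i < 2)%N -> b (inord i) i5 = 0 /\ block_part (inord i) i5 = 0.
  by move=> hi; split; [apply: b_upper0|apply: block_part_upper0]; rewrite ?inordK //; lia.
have [[-> ->] [-> ->]] := (lo5 0 isT, lo5 1 isT).
by rewrite !mul0r !block_part_diag ?inordK.
Qed.

End BlockPart.

Section BlockProjection.
Variables (K : comNzRingType) (q qV : K).
Local Notation P := (Plq q qV).
Local Notation a := (Plq_a q qV).

Lemma block_projection : exists phi : P -> P,
  [/\ super_morphism phi, forall i j, phi (a i j) = block_part a i j
    & forall c, phi (Plq_DV q qV c) = Plq_DV q qV c].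
Proof.
have upper0 := @Plq_a_upper0 K q qV.
have D5 : block_part a i5 i5 = a i5 i5 by rewrite block_part_diag.
apply: Plq_lift => [i j|c|x|i j|c|c|].
- rewrite /block_part; case: ifP => _; last by rewrite /homogeneous linear0.
  exact: Plq_a_homog.
- exact: Plq_DV_homog.
- by apply: block_part_rel => //; apply: Plq_rel0.
- exact: block_part_upper0.
- by rewrite D5 qdet4_block_part //; apply: (Plq_DDV q qV c).
- by rewrite D5 qdet4_block_part //; apply: (Plq_DVD q qV c).
by rewrite qdet4_block_part_Schur //; apply: Plq_Ber.
Qed.

End BlockProjection.

(** * q-commutation of 2x2 quantum determinants *)

Section QCommutation.
Variables (K : comNzRingType) (A : superAlgType K).
Implicit Types (x u v w z c : A).

(** Here (c1, c2) is an extra row below the matrix with rows (x, u) and (v, w). The corrections from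
    [x * c2] and [v * c2] both become r l c1 u w and cancel. *)
Lemma qdet2_col_comm (r l : K) x u v w c1 c2 :
  x * c1 = r *: (c1 * x) -> v * c1 = r *: (c1 * v) ->
  u * c2 = r *: (c2 * u) -> w * c2 = r *: (c2 * w) ->
  u * c1 = c1 * u -> w * c1 = c1 * w ->
  x * c2 = c2 * x + l *: (c1 * u) -> v * c2 = c2 * v + l *: (c1 * w) ->
  let d := x * w - r *: (u * v) in
  d * c1 = r *: (c1 * d) /\ d * c2 = r *: (c2 * d).
Proof.
move=> xc1 vc1 uc2 wc2 uc1 wc1 xc2 vc2 d; split.
  rewrite /d mulrBl mulrBr scalerBr -super_scalerAl -super_scalerAr -!mulrA wc1 vc1.
  rewrite -super_scalerAr !mulrA xc1 uc1 -!super_scalerAl -!mulrA.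
  by congr (_ - _); rewrite super_scalerAl.
rewrite /d mulrBl mulrBr scalerBr -super_scalerAl -super_scalerAr -!mulrA wc2 vc2.
rewrite mulrDr -!super_scalerAr !mulrA uc2 uc1 xc2 mulrDl -!super_scalerAl -!mulrA.
by rewrite !scalerDr !scalerA opprD [r * l]mulrC addrACA subrr addr0.
Qed.

(** Here (c1, c2) is an extra column to the left. The corrections from [w * c1] and [v * c1] cancel
    by the relation between [x] and [u]. *)
Lemma qdet2_row_comm (q qV l : K) x u v w c1 c2 : q * qV = 1 ->
  x * c1 = q *: (c1 * x) -> u * c1 = q *: (c1 * u) ->
  v * c2 = q *: (c2 * v) -> w * c2 = q *: (c2 * w) ->
  x * c2 = c2 * x -> u * c2 = c2 * u ->
  v * c1 = c1 * v - l *: (c2 * x) -> w * c1 = c1 * w - l *: (c2 * u) ->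
  x * u = qV *: (u * x) ->
  let d := x * w - qV *: (u * v) in
  d * c1 = q *: (c1 * d) /\ d * c2 = q *: (c2 * d).
Proof.
move=> qK xc1 uc1 vc2 wc2 xc2 uc2 vc1 wc1 xu d; split.
  rewrite /d mulrBl mulrBr scalerBr -super_scalerAl -super_scalerAr -!mulrA wc1 vc1.
  rewrite !mulrBr -!super_scalerAr !mulrA xc1 uc1 xc2 uc2 -!super_scalerAl -!mulrA xu.
  rewrite -super_scalerAr !scalerBr !scalerA [l * qV]mulrC [qV * q]mulrC.
  by rewrite opprB addrA subrK.
rewrite /d mulrBl mulrBr scalerBr -super_scalerAl -super_scalerAr -!mulrA wc2 vc2.
rewrite -!super_scalerAr !mulrA xc2 uc2 -!mulrA.
by rewrite !scalerA [qV * q]mulrC.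
Qed.

End QCommutation.

(** * Moving C to the left *)

Section Straightening.
Variables (K : comNzRingType) (q qV : K) (A : superAlgType K).
Variables (a : 'I_5 -> 'I_5 -> A) (v : bool -> A) (H : A -> Prop).
Hypotheses (qK : q * qV = 1) (a_rel : forall x, Mq_rel q qV a x -> x = 0).
Hypothesis a_upper0 : forall i j : 'I_5, (i < 2)%N -> (2 <= j)%N -> a i j = 0.
Let D (c : bool) := if c then a i5 i5 else qdet4 qV a.
Hypotheses (Dv : forall c, D c * v c = 1) (vD : forall c, v c * D c = 1).
Hypotheses (H_sub : subalgebra H) (H_v : forall c, H (v c)).
Hypothesis H_a : forall i j : 'I_5, (1 < i)%N = (1 < j)%N -> H (a i j).

Inductive lower_gen : A -> Prop :=
  LowerGen (k l : 'I_5) : (1 < k)%N -> (l < 2)%N -> lower_gen (a k l).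

Let T := prod_span lower_gen H.

Let TZ k x : T x -> T (k *: x). Proof. exact: prod_spanZ. Qed.
Let TB x y : T x -> T y -> T (x - y).
Proof. by move=> Tx Ty; apply: prod_spanD => //; rewrite -scaleN1r; apply: TZ. Qed.

Let qVK : qV * q = 1. Proof. by rewrite mulrC. Qed.

Let sK (b : bool) : (-1) ^+ b * (-1) ^+ b = 1 :> K.
Proof. by rewrite -expr2 sqrr_sign. Qed.

Let scale_inv (s s' : K) (x y : A) : s' * s = 1 -> x = s *: y -> y = s' *: x.
Proof. by move=> e ->; rewrite scalerA e scale1r. Qed.

Let qrowK i : exists s, s * qrow q qV i = 1.
Proof. by rewrite /qrow; case: ifP => _; [exists qV|exists q]. Qed.

(** The two entries commute up to a unit, except for a cross term whose left factor is again a lower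
    entry and whose right factor lies in a diagonal block. *)
Lemma lower_gen_straighten (i j : 'I_5) c : (1 < i)%N = (1 < j)%N -> lower_gen c ->
  T (a i j * c).
Proof.
move=> ij [k l hk hl].
have Ta (i' j' k' l' : 'I_5) : (1 < k')%N -> (l' < 2)%N -> (1 < i')%N = (1 < j')%N ->
    T (a k' l' * a i' j').
  by move=> hk' hl' hij; apply: prod_spanM; [apply: LowerGen|apply: H_a].
have Tkl := Ta i j k l hk hl ij.
have [ik|ik|/val_inj ik] := ltngtP i k; have [jl|jl|/val_inj jl] := ltngtP j l.
- have /subr0_eq/eqP := a_rel (Mq_cross q qV a ik jl).
  rewrite subr_eq => /eqP ->; apply: prod_spanD; apply: TZ => //.
  by apply: Ta => //; lia.
- have /subr0_eq -> := a_rel (@Mq_comm K q qV A a i j k l ltac:(lia)).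
  exact: TZ.
- subst l; have /subr0_eq -> := a_rel (Mq_col q qV a j ik).
  exact: TZ.
- have /subr0_eq -> := a_rel (@Mq_comm K q qV A a i j k l ltac:(lia)).
  exact: TZ.
(* Now (k, l) precedes (i, j), so the cross relation is solved for its second product; the sign is
   its own inverse. *)
- have /subr0_eq/eqP := a_rel (Mq_cross q qV a ik jl).
  rewrite subr_eq addrC -subr_eq => /eqP/esym e.
  rewrite -[a i j * a k l]scale1r -(sK (par_gen (k, l) && par_gen (i, j))) -scalerA e.
  apply: TZ; apply: TB => //; apply: TZ; apply: Ta => //; lia.
- by subst l; lia.
- by subst k; lia.
- subst k; have /subr0_eq e := a_rel (Mq_row q qV a i jl).
  have [s se] := qrowK i.
  rewrite -[a i j * a i l]scale1r -se -[s * _]mulr1.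
  rewrite -(sK (par_gen (i, l) && par_gen (i, j))).
  rewrite [_ * (_ * _)](AC (2*2) ((1*3)*(4*2))) -scalerA -e.
  exact: TZ.
- by subst k l; lia.
Qed.

Let par_even (i j : 'I_5) : (i < 4)%N -> (j < 4)%N -> par_gen (i, j) = false.
Proof. by rewrite /par_gen /par5 /= => hi hj; rewrite !ltn_eqF. Qed.

Let rel_col (i j k : 'I_5) : (i < k)%N -> (i < 4)%N -> (j < 4)%N ->
  a i j * a k j = qV *: (a k j * a i j).
Proof.
move=> ik hi hj; have /subr0_eq := a_rel (Mq_col q qV a j ik).
by rewrite par_even // mul1r /qrow /par5 ltn_eqF.
Qed.

Let rel_row (i j l : 'I_5) : (j < l)%N -> (i < 4)%N -> (j < 4)%N ->
  a i j * a i l = qV *: (a i l * a i j).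
Proof.
move=> jl hi hj; have /subr0_eq := a_rel (Mq_row q qV a i jl).
by rewrite par_even // mul1r /qrow /par5 ltn_eqF.
Qed.

Let rel_comm (i j k l : 'I_5) : (i < k)%N && (l < j)%N || (k < i)%N && (j < l)%N ->
  (i < 4)%N -> (j < 4)%N -> a i j * a k l = a k l * a i j.
Proof.
move=> h hi hj; have /subr0_eq := a_rel (Mq_comm q qV a h).
by rewrite par_even // scale1r.
Qed.

Let rel_cross (i j k l : 'I_5) : (i < k)%N -> (j < l)%N -> (i < 4)%N -> (j < 4)%N ->
  a i j * a k l = a k l * a i j + (qV - q) *: (a k j * a i l).
Proof.
move=> ik jl hi hj; have /subr0_eq/eqP := a_rel (Mq_cross q qV a ik jl).
by rewrite par_even // scale1r mul1r subr_eq addrC => /eqP.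
Qed.

(** The determinant of the block x contributes q^-1 against every lower entry; that of y contributes
    q against rows 3 and 4 and commutes with row 5. The total scalar, 1 or q^-1, is a unit. *)
Let det_comm (k l : 'I_5) : (1 < k)%N -> (l < 2)%N ->
  exists2 s, D false * a k l = s *: (a k l * D false) & exists s', s' * s = 1.
Proof.
move=> hk hl; rewrite /D qdet4_upper0 //.
pose g (i : nat) : 'I_5 := inord i.
have gE (i : nat) : (i < 5)%N -> g i = i :> nat by move=> hi; rewrite inordK.
have [lE kE] : (l = g 0 \/ l = g 1) /\ ((k = g 2 \/ k = g 3) \/ k = g 4).
  have ordE (m : 'I_5) (i : nat) : m = i :> nat -> m = g i.
    by move=> <-; rewrite /g inord_val.
  split; first by case: (ltnP 0 l) => h; [right|left]; apply: ordE; lia.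
  have := ltn_ord k.
  by case: (ltngtP k 3) => h; [left; left|right|left; right]; apply: ordE; lia.
rewrite -!/(g _).
set dx := a (g 0) (g 0) * _ - _; set dy := a (g 2) (g 2) * _ - _.
have dxc : dx * a k l = qV *: (a k l * dx).
  have [e0 e1] : dx * a k (g 0) = qV *: (a k (g 0) * dx) /\
                 dx * a k (g 1) = qV *: (a k (g 1) * dx).
    apply: (@qdet2_col_comm K A qV (qV - q)).
    - by apply: rel_col; rewrite ?gE //; lia.
    - by apply: rel_col; rewrite ?gE //; lia.
    - by apply: rel_col; rewrite ?gE //; lia.
    - by apply: rel_col; rewrite ?gE //; lia.
    - by apply: rel_comm; rewrite ?gE //; lia.
    - by apply: rel_comm; rewrite ?gE //; lia.
    - by apply: rel_cross; rewrite ?gE //; lia.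
    - by apply: rel_cross; rewrite ?gE //; lia.
  by case: lE => ->.
have [e2 e3] : dy * a (g 2) l = q *: (a (g 2) l * dy) /\
               dy * a (g 3) l = q *: (a (g 3) l * dy).
  have row (i j : 'I_5) : (1 < i)%N -> (i < 4)%N -> (1 < j)%N -> (j < 4)%N ->
      a i j * a i l = q *: (a i l * a i j).
    by move=> *; apply: (scale_inv qK); apply: rel_row => //; lia.
  have cross (i j : 'I_5) : (1 < j)%N -> (j < 4)%N -> (1 < i)%N -> (i < 4)%N ->
      (2 < i)%N -> a i j * a (g 2) l = a (g 2) l * a i j - (qV - q) *: (a i l * a (g 2) j).
    move=> *; rewrite (@rel_cross (g 2) l i j) ?gE //; try lia.
    by rewrite addrK.
  apply: (@qdet2_row_comm K A q qV (qV - q) _ _ _ _ _ _ qK).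
  - by apply: row; rewrite ?gE.
  - by apply: row; rewrite ?gE.
  - by apply: row; rewrite ?gE.
  - by apply: row; rewrite ?gE.
  - by apply: rel_comm; rewrite ?gE //; lia.
  - by apply: rel_comm; rewrite ?gE //; lia.
  - by apply: cross; rewrite ?gE.
  - by apply: cross; rewrite ?gE.
  - by apply: rel_row; rewrite ?gE.
have dxdy s : dy * a k l = s *: (a k l * dy) ->
    dx * dy * a k l = (s * qV) *: (a k l * (dx * dy)).
  move=> e; rewrite -mulrA e -super_scalerAr mulrA dxc -super_scalerAl scalerA.
  by rewrite mulrA.
case: kE => [kE|kE].
  exists (q * qV); last by exists 1; rewrite mul1r.
  by apply: dxdy; case: kE => ->.
exists (1 * qV); last by exists q; rewrite mul1r.
apply: dxdy; rewrite scale1r /dy kE mulrBl mulrBr -super_scalerAl -super_scalerAr.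
have c4 (i j : 'I_5) : (1 < i)%N -> (i < 4)%N -> (1 < j)%N -> (j < 4)%N ->
    a i j * a (g 4) l = a (g 4) l * a i j.
  by move=> *; apply: rel_comm; rewrite ?gE //; lia.
rewrite -!mulrA ![a _ _ * a (g 4) l]c4 ?gE //.
by rewrite ![a _ _ * (a (g 4) l * _)]mulrA ![a _ _ * a (g 4) l]c4 ?gE // -!mulrA.
Qed.

(* D_1 is the product of the quantum determinants of the two diagonal blocks,  *)
(* each of which q-commutes with C, while D_2 does so only modulo row 5 of C.   *)
Lemma lower_gen_straighten_inv (b : bool) c : lower_gen c -> T (v b * c).
Proof.
have comm_inv x s : D b * x = s *: (x * D b) -> (exists s', s' * s = 1) ->
    exists s', v b * x = s' *: (x * v b).
  move=> e [s' se]; exists s'; apply: (scale_inv se).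
  rewrite -[x in LHS]mul1r -(vD b) -!mulrA [D b * _]mulrA e -super_scalerAl -super_scalerAr.
  by rewrite -mulrA Dv mulr1.
case=> k l hk hl; case: b comm_inv => comm_inv; last first.
  have [s e si] := det_comm hk hl; have [s' ->] := comm_inv _ _ e si.
  by apply: TZ; apply: prod_spanM.
have h5 : exists s, v true * a i5 l = s *: (a i5 l * v true).
  apply: (comm_inv _ qV); last by exists q.
  have l5 : (l < i5)%N by rewrite /=; lia.
  have /subr0_eq e := a_rel (Mq_row q qV a i5 l5).
  apply: (scale_inv qVK); move: e.
  by rewrite {2}/par_gen andbF mul1r /qrow.
have [k5|k5] : (k = i5) \/ (k < i5)%N.
  - case: (ltngtP k i5) => [|h|h]; [by right| |by left; apply: val_inj].
    by move: (ltn_ord k) h => /=; lia.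
- rewrite k5; have [s ->] := h5; apply: TZ.
  by apply: prod_spanM.
have l5 : (l < i5)%N by rewrite /=; lia.
have e : a k l * a i5 i5 = a i5 i5 * a k l + (qV - q) *: (a i5 l * a k i5).
  have /subr0_eq/eqP := a_rel (Mq_cross q qV a k5 l5).
  have -> : par_gen (i5, i5) = false by [].
  rewrite par_even // ?(ltn_trans hl) //.
  by rewrite andbF scale1r mul1r subr_eq addrC => /eqP.
have [s sE] := h5.
(* The cross relation is multiplied by the inverse of D_2 on both sides, and that inverse then
   passes [a i5 l] at the cost of [s]; all that follows [a i5 l] lies in [H]. *)
have -> : v true * a k l = a k l * v true +
    ((qV - q) * s) *: (a i5 l * (v true * (a k i5 * v true))).
  have : v true * (a k l * a i5 i5) * v true = a k l * v true + 
     ((qV - q)) *: (v true * a i5 l * a k i5 * v true).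
    rewrite e mulrDr mulrDl mulrA (vD true) mul1r -super_scalerAr -super_scalerAl.
    by rewrite !mulrA.
  by rewrite sE -!super_scalerAl scalerA -!mulrA (Dv true) mulr1 => ->.
apply: prod_spanD; first exact: prod_spanM.
apply: TZ; apply: prod_spanM => //.
have [_ _ HM] := H_sub; apply: (HM) => //; apply: (HM) => //; apply: H_a.
by rewrite hk.
Qed.
End Straightening.

(** * The coaction *)

Lemma homogeneous_sum (K : comNzRingType) (A : superAlgType K) b n (F : 'I_n -> A) :
  (forall i, homogeneous b (F i)) -> homogeneous b (\sum_(i < n) F i).
Proof. by move=> h; rewrite /homogeneous linear_sum; apply: eq_bigr => i _; apply: h. Qed.

Lemma sum_I5 (V : zmodType) (F : 'I_5 -> V) :
  \sum_(k < 5) F k = \sum_(m < 2) F (lo m) + \sum_(m < 2) F (hi m) + F i5.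
Proof.
rewrite !big_ord_recl !big_ord0 !addr0 !addrA.
by congr (F _ + F _ + F _ + F _ + F _); apply: val_inj; rewrite //= ?inordK.
Qed.

Lemma lo_lt2 (i : 'I_2) : (lo i < 2)%N.
Proof. exact: (ltn_ord i). Qed.

Lemma hi_gt1 (i : 'I_2) : (1 < hi i)%N.
Proof. by rewrite inordK //; case: i => /= *; lia. Qed.

Lemma par_gen_lo (i j : 'I_2) : par_gen (lo i, lo j) = false.
Proof. by case: i j => [[|[|//]] ?] [[|[|//]] ?]. Qed.

Section QuantumBigCell.
Variables (K : comNzRingType) (q qV : K) (A : superAlgType K) (HA : hopfSuper A).
Variables (a : 'I_5 -> 'I_5 -> A) (v : bool -> A) (phi : A -> A).
Hypotheses (qK : q * qV = 1) (a_rel : forall x, Mq_rel q qV a x -> x = 0)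
  (a_upper0 : forall i j : 'I_5, (i < 2)%N -> (2 <= j)%N -> a i j = 0)
  (a_homog : forall i j, homogeneous (par_gen (i, j)) (a i j))
  (Dv : forall c : bool, (if c then a i5 i5 else qdet4 qV a) * v c = 1)
  (vD : forall c : bool, v c * (if c then a i5 i5 else qdet4 qV a) = 1)
  (a_ind : forall V : A -> Prop, subalgebra V -> (forall i j, V (a i j)) ->
     (forall c, V (v c)) -> forall x, V x)
  (a_ext : forall (B : superAlgType K) (f g : A -> B), super_morphism f ->
     super_morphism g -> (forall i j, f (a i j) = g (a i j)) -> f =1 g).
Hypotheses (phi_mor : super_morphism phi)
  (phi_a : forall i j, phi (a i j) = block_part a i j)
  (phi_v : forall c, phi (v c) = v c).
Hypotheses (comul_a : forall i j, comul HA (a i j) = \sum_(k < 5) a i k \ox a k j)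
  (counit_a : forall i j, counit HA (a i j) = (i == j)%:R).

Let phi0 := lin0 (smor_lin phi_mor).

Lemma phi_idem x : phi (phi x) = phi x.
Proof.
move: x; apply: a_ext => [||i j] //; first exact: (smor_comp phi_mor phi_mor).
rewrite phi_a /block_part; case: ifP => ij //.
by rewrite phi_a /block_part ij.
Qed.

(** When (i, j) is in a diagonal block, the terms whose [k] is in the other block contain an upper
    entry and vanish already. Otherwise every [k] leaves a killed factor. *)
Lemma phi_comul x : comul HA (phi x) = tens_map phi phi (comul HA x).
Proof.
have mm := tens_map_morphism phi_mor phi_mor.
move: x; apply: a_ext => [||i j].
- exact: (smor_comp phi_mor (comul_morphism HA)).
- exact: (smor_comp (comul_morphism HA) mm).
rewrite phi_a comul_a (lin_sum (smor_lin mm)).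
have -> : \sum_(k < 5) tens_map phi phi (a i k \ox a k j) =
    \sum_(k < 5) block_part a i k \ox block_part a k j.
  by apply: eq_bigr => k _; rewrite tens_mapE ?phi_a //; apply: smor_lin.
rewrite /block_part; case: (boolP ((1 < i)%N == (1 < j)%N)) => ij.
  rewrite comul_a; apply: eq_bigr => k _; case: ifP => ik.
    by rewrite -(eqP ik) ij.
  case: (ltnP 1 i) ik ij => hi /= ik /eqP ij.
    by rewrite (@a_upper0 k j) ?if_same ?tens0r //; lia.
  by rewrite (@a_upper0 i k) ?tens0l //; lia.
rewrite (lin0 (smor_lin (comul_morphism HA))); apply/esym/big1 => k _.
by case: ifP => [/eqP <-|_]; rewrite ?(negPf ij) ?tens0r ?tens0l.
Qed.

Let x (i j : 'I_2) : A := a (lo i) (lo j).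
Let Sx (i j : 'I_2) : A := antipode HA (x i j).

Let x_even i j : homogeneous false (x i j).
Proof. by rewrite -(par_gen_lo i j). Qed.

Let Sx_even i j : homogeneous false (Sx i j).
Proof. by rewrite /homogeneous -antipode_hpart x_even. Qed.

Let counit_x i j : counit HA (x i j) = (i == j)%:R.
Proof. by rewrite counit_a -(inj_eq val_inj) /= (inj_eq val_inj). Qed.

Lemma sum_lo_upper0 (V : zmodType) (i : 'I_2) (F : 'I_5 -> V) :
  (forall m : 'I_5, a (lo i) m = 0 -> F m = 0) ->
  \sum_(k < 5) F k = \sum_(m < 2) F (lo m).
Proof.
move=> F0; have z (k : 'I_5) : (1 < k)%N -> F k = 0.
  by move=> hk; apply/F0/a_upper0; rewrite ?lo_lt2.
rewrite sum_I5 [X in _ + X + _]big1 => [|m _]; last exact/z/hi_gt1.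
by rewrite z // !addr0.
Qed.

Lemma comul_x i j : comul HA (x i j) = \sum_(m < 2) x i m \ox x m j.
Proof.
rewrite comul_a (sum_lo_upper0 (i := i)) // => m ->.
by rewrite tens0l.
Qed.

Lemma antipode_mulr i j : \sum_(m < 2) x i m * Sx m j = (i == j)%:R.
Proof.
have bl : bilin (fun a b : A => a * antipode HA b).
  split=> [c|c] k u w; first by rewrite mulrDl super_scalerAl.
  by rewrite (antipode_linear HA) mulrDr super_scalerAr.
have := antipoder HA (x i j).
rewrite comul_x (lin_sum (tens_lift_linear bl)) counit_x scaler_nat => <-.
by apply: eq_bigr => m _; rewrite (tens_liftE bl).
Qed.

Lemma antipode_mull i j : \sum_(m < 2) Sx i m * x m j = (i == j)%:R.
Proof.
have bl : bilin (fun a b : A => antipode HA a * b).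
  split=> [c|c] k u w; last by rewrite mulrDr super_scalerAr.
  by rewrite (antipode_linear HA) mulrDl super_scalerAl.
have := antipodel HA (x i j).
rewrite comul_x (lin_sum (tens_lift_linear bl)) counit_x scaler_nat => <-.
by apply: eq_bigr => m _; rewrite (tens_liftE bl).
Qed.

Lemma sum_delta (R : pzRingType) (F : 'I_2 -> R) j : \sum_(m < 2) F m * (m == j)%:R = F j.
Proof.
rewrite (bigD1 j) //= eqxx mulr1 big1 ?addr0 // => m /negPf ->.
by rewrite mulr0.
Qed.

(* The entries of C x^-1: [t] for k in {3,4} and [ttau] for k = 5. *)
Definition coset_coord (k : 'I_5) (j : 'I_2) : A := \sum_(m < 2) a k (lo m) * Sx m j.
Local Notation tt := coset_coord.

Lemma coset_coord_mul k l : \sum_(j < 2) tt k j * x j l = a k (lo l).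
Proof.
under eq_bigr => j _ do rewrite mulr_suml.
rewrite exchange_big /= -[RHS](sum_delta (fun m => a k (lo m)) l).
apply: eq_bigr => m _; rewrite -antipode_mull mulr_sumr.
by apply: eq_bigr => j _; rewrite mulrA.
Qed.

(* Right multiplication by f(x) is injective, with inverse f(S x). *)
Lemma coset_coord_unique (B : superAlgType K) (f : A -> B) k (F : 'I_2 -> B) :
  super_morphism f ->
  (forall l, \sum_(j < 2) F j * f (x j l) = f (a k (lo l))) ->
  forall j, F j = f (tt k j).
Proof.
move=> fm hF j; rewrite -[LHS](sum_delta F j).
have fd m : (m == j)%:R = f ((m == j)%:R) :> B.
  by case: (m == j); rewrite ?(smor1 fm) ?(lin0 (smor_lin fm)).
under eq_bigr => m _ do rewrite fd -antipode_mulr (lin_sum (smor_lin fm)) mulr_sumr.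
rewrite exchange_big /= (lin_sum (smor_lin fm)); apply: eq_bigr => l _.
rewrite (smorM fm) -hF mulr_suml; apply: eq_bigr => m _.
by rewrite (smorM fm) mulrA.
Qed.

Lemma coset_coord_homog k j : homogeneous (par5 k) (tt k j).
Proof.
apply: homogeneous_sum => m; rewrite -[par5 k]addbF; apply: homogeneousM => //.
have <- : par_gen (k, lo m) = par5 k; last exact: a_homog.
by rewrite /par_gen /=; case: m => [[|[|//]] ?] /=; rewrite addbF.
Qed.

(** The coaction multiplies both C and x on the right by 1 \ox x, so the quotient C x^-1 only
    acquires \ox 1. *)
Lemma coset_coord_coinv k j :
  proj_coaction HA phi (tt k j) = tt k j \ox 1.
Proof.
have pm := proj_coaction_morphism HA phi_mor; have phl := smor_lin phi_mor.
have pl := smor_lin (tens_map_morphism (smor_id A) phi_mor).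
have px k' l : proj_coaction HA phi (a k' (lo l)) = \sum_(m < 2) a k' (lo m) \ox x m l.
  rewrite /proj_coaction comul_a (lin_sum pl) sum_I5 /=.
  have bl := lo_lt2 l.
  have off (m : 'I_5) : (1 < m)%N -> tens_map id phi (a k' m \ox a m (lo l)) = 0.
    by move=> hm; rewrite tens_mapE // phi_a block_part_off ?tens0r //; lia.
  rewrite [X in _ + X + _]big1 => [|m _]; last by apply: off; apply: hi_gt1.
  rewrite off // !addr0; apply: eq_bigr => m _.
  by rewrite tens_mapE // phi_a block_part_diag //; have := lo_lt2 m; lia.
apply/esym/(@coset_coord_unique _ _ k (fun j => tt k j \ox 1) pm) => l.
rewrite px; under eq_bigr => m _ do rewrite px mulr_sumr.
rewrite exchange_big /=; apply: eq_bigr => n _.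
rewrite -coset_coord_mul tens_suml; apply: eq_bigr => m _.
by rewrite tensM_evenr ?mul1r //; apply: x_even.
Qed.

(** [phi] fixes x, hence its inverse: phi(S x) = phi(S x) x S(x) = phi(S(x) x) S(x). *)
Lemma phi_Sx i j : phi (Sx i j) = Sx i j.
Proof.
have phx m l : phi (x m l) = x m l.
  by rewrite phi_a block_part_diag //; have := lo_lt2 m; have := lo_lt2 l; lia.
have phd m l : phi ((m == l)%:R) = (m == l)%:R.
  by case: (m == l); rewrite ?(smor1 phi_mor).
transitivity (\sum_(m < 2) phi (Sx i m) * (m == j)%:R); first by rewrite sum_delta.
under eq_bigr => m _ do rewrite -antipode_mulr mulr_sumr.
rewrite exchange_big /=.
transitivity (\sum_(l < 2) (i == l)%:R * Sx l j).
  apply: eq_bigr => l _; rewrite -phd -antipode_mull (lin_sum (smor_lin phi_mor)) mulr_suml.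
  by apply: eq_bigr => m _; rewrite (smorM phi_mor) phx mulrA.
rewrite (bigD1 i) //= eqxx mul1r big1 ?addr0 // => l.
by rewrite eq_sym => /negPf ->; rewrite mul0r.
Qed.

Let H (h : A) := phi h = h.

Let H_sub : subalgebra H.
Proof. exact: subalgebra_eq phi_mor (smor_id A). Qed.

Let H_a (i j : 'I_5) : (1 < i)%N = (1 < j)%N -> H (a i j).
Proof. by move=> ij; rewrite /H phi_a block_part_diag. Qed.

(* [h] ranges over the image of [phi], so it suffices to treat the generators. *)
Lemma lower_gen_straighten_fixed h c : H h -> lower_gen a c ->
  prod_span (lower_gen a) H (h * c).
Proof.
move=> <- lc; have l0 d : lower_gen a d -> prod_span (lower_gen a) H (0 * d).
  by move=> ld; rewrite mul0r -[0](mulr0 d); apply: prod_spanM.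
move: h c lc; apply: a_ind => [|i j c lc|c d ld].
- split=> [c lc|k u w hu hw c lc|u w hu hw c lc].
  + by rewrite (smor1 phi_mor) mul1r; apply: prod_span_id.
  + rewrite (smor_lin phi_mor) mulrDl -super_scalerAl.
    by apply: prod_spanD; [apply: prod_spanZ => //; apply: hu|apply: hw].
  + rewrite (smorM phi_mor) -mulrA.
    elim: (hw c lc) => [g h lg Hh|y z _ hy _ hz]; last by rewrite mulrDr; apply: prod_spanD.
    by rewrite mulrA; apply: prod_spanMr => //; apply: hu.
- rewrite phi_a /block_part; case: ifP => [/eqP ij|_]; last exact: l0.
  exact: (lower_gen_straighten qK a_rel H_sub H_a).
- rewrite phi_v.
  exact: (lower_gen_straighten_inv qK a_rel a_upper0 Dv vD H_sub phi_v H_a).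
Qed.

(** * The big cell as the algebra of coset coordinates *)

Variables (t : 'M[A]_2) (ttau : 'rV[A]_2).
Hypotheses (t_x : forall i l, \sum_(j < 2) t i j * x j l = a (hi i) (lo l))
  (ttau_x : forall l, \sum_(j < 2) ttau 0 j * x j l = a i5 (lo l)).

Lemma tE i j : t i j = tt (hi i) j.
Proof. exact: (coset_coord_unique (k := hi i) (smor_id A) (t_x i)). Qed.

Lemma ttauE j : ttau 0 j = tt i5 j.
Proof. exact: (coset_coord_unique (k := i5) (smor_id A) ttau_x). Qed.

Variable S : A -> Prop.
Hypotheses (S_t : forall i j, S (t i j)) (S_ttau : forall j, S (ttau 0 j))
  (S_inv : forall s, S s -> (exists i j, s = t i j) \/ exists j, s = ttau 0 j).

Lemma S_coord (k : 'I_5) (j : 'I_2) : (1 < k)%N -> S (tt k j).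
Proof.
move=> hk; have [[m ->]|->] : (exists m, k = hi m) \/ k = i5.
  case: k hk => [[|[|[|[|[|//]]]]] hk] // _; last by right; apply: val_inj.
    by left; exists ord0; apply: val_inj; rewrite /= inordK.
  by left; exists ord_max; apply: val_inj; rewrite /= inordK.
- by rewrite -tE.
- by rewrite -ttauE.
Qed.

Lemma coord_S s : S s -> exists (k : 'I_5) (j : 'I_2), (1 < k)%N /\ s = tt k j.
Proof.
case/S_inv => [[i [j ->]]|[j ->]].
  by exists (hi i), j; rewrite hi_gt1 tE.
by exists i5, j; rewrite ttauE.
Qed.

Lemma coord_homog s : S s -> exists b, homogeneous b s.
Proof.
by move=> /coord_S[k [j [_ ->]]]; exists (par5 k); apply: coset_coord_homog.
Qed.

(** Straightening concerns the entries of C, generation those of T; T = C S(x) and C = T x translate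
    between them, as x and S(x) have entries in [H]. *)
Lemma coord_prod_span y : prod_span (sub_gen S) H y.
Proof.
have sum2 (F : 'I_2 -> A) (G : A -> Prop) : (forall m, prod_span G H (F m)) ->
    prod_span G H (\sum_(m < 2) F m).
  by move=> hF; rewrite !big_ord_recl big_ord0 addr0; apply: prod_spanD.
have Hx i j : H (x i j) by apply: H_a; have := lo_lt2 i; have := lo_lt2 j; lia.
have lowerE (k l : 'I_5) : (l < 2)%N -> exists m, a k l = \sum_(j < 2) tt k j * x j m.
  move=> hl; exists (Ordinal hl); rewrite coset_coord_mul.
  by congr (a _ _); apply: val_inj.
have TW z : prod_span (lower_gen a) H z -> prod_span (sub_gen S) H z.
  elim=> [g h [k l hk hl] Hh|u w _ hu _ hw]; last exact: prod_spanD.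
  have [m ->] := lowerE k l hl; rewrite mulr_suml; apply: sum2 => j; rewrite -mulrA.
  apply: prod_spanM; last exact: (subalgebraM H_sub).
  by apply: sub_gen_mem; apply: S_coord.
apply: (prod_span_all coord_homog H_sub) => [h s Hh|V Vs VS VH].
  move=> /coord_S[k [j [hk ->]]]; apply: TW; rewrite /tt mulr_sumr.
  apply: sum2 => m; rewrite mulrA; apply: prod_spanMr => //; last exact: phi_Sx.
  by apply: lower_gen_straighten_fixed => //; apply: LowerGen; rewrite ?lo_lt2.
have [V1 VP VM] := Vs.
apply: a_ind => // [i j|c]; last exact: VH.
case: (boolP ((1 < i)%N == (1 < j)%N)) => [/eqP ij|ij]; first exact/VH/H_a.
case: (ltnP 1 i) ij => hi ij; last first.
  rewrite a_upper0 //; last by lia.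
  by rewrite -(scale0r (1 : A)); apply: subalgebraZ.
have VD u w : V u -> V w -> V (u + w).
  by move=> hu hw; rewrite -[u]scale1r; apply: VP.
have hj : (j < 2)%N by lia.
have [m ->] := lowerE i j hj; rewrite !big_ord_recl big_ord0 addr0.
by apply: VD; apply: VM; first [exact/VS/S_coord|exact/VH/Hx].
Qed.

Lemma coord_retraction : exists r : A -> A,
  [/\ linear r, forall y, sub_gen S (r y) & forall u, sub_gen S u -> r u = u].
Proof.
have coinv s : S s -> proj_coaction HA phi s = s \ox 1.
  by move=> /coord_S[k [j [_ ->]]]; apply: coset_coord_coinv.
exists (hopf_retraction HA phi); split.
- exact: hopf_retraction_linear.
- move=> y; apply: hopf_retraction_sub => //.
  + exact: phi_idem.
  + exact: phi_comul.
  + exact: coord_homog.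
  + exact: coord_prod_span.
- move=> u; apply: hopf_retraction_id => //.
  + exact: phi_idem.
  + exact: phi_comul.
  + exact: coord_homog.
Qed.

Local Notation U := (sub_super S).
Local Notation incl := (@sub_incl K A S).

(** The matrix identity (S(x) \ox 1) Delta(x) = 1 \ox x: it brings x next to T in the second factor,
    where T x = C. *)
Lemma sum_antipode_comul (p u : A) b l :
  \sum_(j < 2) ((p * Sx b j) \ox u) * comul HA (x j l) = p \ox (u * x b l).
Proof.
under eq_bigr => j _ do rewrite comul_x mulr_sumr.
rewrite exchange_big /=.
transitivity (\sum_(n < 2) (p * (b == n)%:R) \ox (u * x n l)).
  apply: eq_bigr => n _; rewrite -antipode_mull mulr_sumr tens_suml.
  by apply: eq_bigr => j _; rewrite tensM_evenr ?mulrA //; apply: x_even.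
rewrite (bigD1 b) //= eqxx mulr1 big1 ?addr0 // => n.
by rewrite eq_sym => /negPf ->; rewrite mulr0 tens0l.
Qed.

(** * Comultiplication of the generators and the resulting coaction *)

Variables (tau xi : 'rV[A]_2) (eta : 'cV[A]_2).
Hypotheses (tauE : forall j, a i5 i5 * tau 0 j = a i5 (lo j))
  (xiE : forall j, a i5 i5 * xi 0 j = a i5 (hi j))
  (etaE : forall i, \sum_(j < 2) a (hi i) (hi j) * eta j 0 = a (hi i) i5).

(** After right multiplication by Delta(x), the three summands are the parts of Delta(C) with middle
    index in {1,2}, in {3,4} and equal to 5, the last one rewritten through y eta. *)
Lemma comul_t i j : comul HA (t i j) =
  t i j \ox 1
  + \sum_(b < 2) \sum_(c < 2) (a (hi i) (hi b) * Sx c j) \ox t b c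
  + \sum_(b < 2) \sum_(c < 2) (a (hi i) (hi b) * eta b 0 * Sx c j) \ox ttau 0 c.
Proof.
rewrite [in LHS]tE; apply/esym; move: j.
apply: (coset_coord_unique (k := hi i) (comul_morphism HA)) => l.
rewrite comul_a sum_I5.
under eq_bigr => j _ do rewrite !mulrDl !mulr_suml.
rewrite !big_split /=; congr (_ + _ + _).
- under eq_bigr => j _ do rewrite comul_x mulr_sumr.
  rewrite exchange_big; apply: eq_bigr => n _ /=.
  rewrite -(coset_coord_mul (hi i)) tens_suml; apply: eq_bigr => j _.
  by rewrite tensM_evenr ?mul1r ?tE //; apply: x_even.
- rewrite exchange_big; apply: eq_bigr => b _ /=.
  under eq_bigr => j _ do rewrite mulr_suml.
  rewrite exchange_big -(coset_coord_mul (hi b)) tens_sumr; apply: eq_bigr => c _ /=.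
  by rewrite sum_antipode_comul tE.
- rewrite -etaE tens_suml exchange_big; apply: eq_bigr => b _ /=.
  under eq_bigr => j _ do rewrite mulr_suml.
  rewrite exchange_big -(coset_coord_mul i5) tens_sumr; apply: eq_bigr => c _ /=.
  by rewrite sum_antipode_comul ttauE.
Qed.

(** The same computation in row 5, whose entries are d tau, d xi and d. No sign appears because d
    and S(x) are even. *)
Lemma comul_ttau j : comul HA (ttau 0 j) =
  \sum_(b < 2) (a i5 i5 \ox 1)
    * (tau 0 b \ox 1 + \sum_(c < 2) xi 0 c \ox t c b + 1 \ox ttau 0 b)
    * (Sx b j \ox 1).
Proof.
rewrite [in LHS]ttauE; apply/esym; move: j.
apply: (coset_coord_unique (k := i5) (comul_morphism HA)) => l.
have h1 := homogeneous1 A.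
have e (p u : A) b :
    \sum_(j < 2) (a i5 i5 \ox 1) * (p \ox u) * (Sx b j \ox 1) * comul HA (x j l) =
    (a i5 i5 * p) \ox (u * x b l).
  rewrite -sum_antipode_comul; apply: eq_bigr => j _; congr (_ * _).
  by rewrite tensM_evenl // mul1r tensM_evenr ?mulr1 //; apply: Sx_even.
rewrite comul_a sum_I5.
under eq_bigr => j _ do rewrite mulr_suml.
rewrite exchange_big /=.
transitivity (\sum_(b < 2) ((a i5 i5 * tau 0 b) \ox (1 * x b l)
  + \sum_(c < 2) (a i5 i5 * xi 0 c) \ox (t c b * x b l)
  + (a i5 i5 * 1) \ox (ttau 0 b * x b l))).
  apply: eq_bigr => b _; rewrite -!e.
  under [X in _ = _ + X + _]eq_bigr => c _ do rewrite -e.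
  rewrite [X in _ = _ + X + _]exchange_big -!big_split; apply: eq_bigr => j _ /=.
  by rewrite !mulrDr !mulrDl !mulr_sumr !mulr_suml.
rewrite !big_split /=; congr (_ + _ + _).
- by apply: eq_bigr => b _; rewrite tauE mul1r.
- rewrite exchange_big; apply: eq_bigr => c _ /=.
  rewrite -(coset_coord_mul (hi c)) tens_sumr.
  by apply: eq_bigr => b _; rewrite xiE tE.
- rewrite mulr1 -(coset_coord_mul i5) tens_sumr.
  by apply: eq_bigr => b _; rewrite ttauE.
Qed.

Theorem big_cell_coaction : exists Dt : U -> tens A U,
  [/\ left_coaction HA Dt,
      forall u, tens_map id incl (Dt u) = comul HA (incl u),
      forall i j : 'I_2, Dt (sub_elt (S_t i j)) =
        t i j \ox 1
        + \sum_(b < 2) \sum_(c < 2) (a (hi i) (hi b) * Sx c j) \ox sub_elt (S_t b c)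
        + \sum_(b < 2) \sum_(c < 2)
            (a (hi i) (hi b) * eta b 0 * Sx c j) \ox sub_elt (S_ttau c)
    & forall j : 'I_2, Dt (sub_elt (S_ttau j)) =
        \sum_(b < 2) (a i5 i5 \ox 1)
          * (tau 0 b \ox 1 + \sum_(c < 2) xi 0 c \ox sub_elt (S_t c b)
             + 1 \ox sub_elt (S_ttau b))
          * (Sx b j \ox 1)].
Proof.
have [r [r_lin r_sub r_id]] := coord_retraction.
have im := tens_map_morphism (smor_id A) (sub_incl_morphism S).
have il := smor_lin im; have sl := smor_lin (sub_incl_morphism S).
have iE p u : tens_map id incl (p \ox u) = p \ox incl u by rewrite tens_mapE.
have i1 : incl 1 = 1 := smor1 (sub_incl_morphism S).
(* The claimed values lie in [tens A U] and map to the comultiplication of the generators. They thus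
   serve twice: as the lifts that give the coaction and, by injectivity, as its values. *)
have i_t i j : tens_map id incl (t i j \ox 1
    + \sum_(b < 2) \sum_(c < 2) (a (hi i) (hi b) * Sx c j) \ox sub_elt (S_t b c)
    + \sum_(b < 2) \sum_(c < 2)
        (a (hi i) (hi b) * eta b 0 * Sx c j) \ox sub_elt (S_ttau c)) = comul HA (t i j).
  rewrite comul_t !(linD il) iE i1 !(lin_sum il); congr (_ + _ + _);
    by apply: eq_bigr => b _; rewrite (lin_sum il); apply: eq_bigr => c _; rewrite iE.
have i_ttau j : tens_map id incl (\sum_(b < 2) (a i5 i5 \ox 1)
    * (tau 0 b \ox 1 + \sum_(c < 2) xi 0 c \ox sub_elt (S_t c b)
       + 1 \ox sub_elt (S_ttau b))
    * (Sx b j \ox 1)) = comul HA (ttau 0 j).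
  rewrite comul_ttau (lin_sum il); apply: eq_bigr => b _.
  rewrite !(smorM im) !(linD il) (lin_sum il) !iE i1.
  by congr (_ * (_ + _ + _) * _); apply: eq_bigr => c _; rewrite iE.
have inj := @tens_incl_inj K A S r r_lin r_sub r_id A.
have lift s : S s -> exists w, tens_map id incl w = comul HA s.
  case/S_inv => [[i [j ->]]|[j ->]]; eexists; [exact: i_t|exact: i_ttau].
have [Dt [coact DtE]] := restricted_coaction coord_homog r_lin r_sub r_id lift.
exists Dt; split=> // [i j|j]; apply: inj; rewrite DtE.
  by rewrite i_t.
by rewrite i_ttau.
Qed.

Corollary big_cell_coaction_mx (X Y : 'M[A]_2) (d : A) :
  (forall i j, X i j = a (lo i) (lo j)) -> (forall i j, Y i j = a (hi i) (hi j)) ->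
  d = a i5 i5 ->
  exists Dt : U -> tens A U,
  [/\ left_coaction HA Dt,
      forall u, tens_map id incl (Dt u) = comul HA (incl u),
      forall i j : 'I_2, Dt (sub_elt (S_t i j)) =
        t i j \ox 1
        + \sum_(b < 2) \sum_(c < 2) (Y i b * antipode HA (X c j)) \ox sub_elt (S_t b c)
        + \sum_(b < 2) \sum_(c < 2)
            (Y i b * eta b 0 * antipode HA (X c j)) \ox sub_elt (S_ttau c)
    & forall j : 'I_2, Dt (sub_elt (S_ttau j)) =
        \sum_(b < 2) (d \ox 1)
          * (tau 0 b \ox 1 + \sum_(c < 2) xi 0 c \ox sub_elt (S_t c b)
             + 1 \ox sub_elt (S_ttau b))
          * (antipode HA (X b j) \ox 1)].
Proof.
move=> XE YE ->; have [Dt [coact DtE Dt_t Dt_ttau]] := big_cell_coaction.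
exists Dt; split=> // [i j|j].
  rewrite Dt_t; congr (_ + _ + _); apply: eq_bigr => b _; apply: eq_bigr => c _;
    by rewrite XE YE.
by rewrite Dt_ttau; apply: eq_bigr => b _; rewrite XE.
Qed.

End QuantumBigCell.

Theorem proposition6p7 (R : realType)
    (* the Hopf superalgebra O(SL_q(4|1)) and its quotient O(P_{l,q}) *)
    (HSL : hopfSuper (SLq (Cq_q R) (Cq_qV R)))
    (HP : hopfSuper (Plq (Cq_q R) (Cq_qV R)))
    (hSL : SLq_hopf_spec HSL)
    (hP : hopf_morphism HSL HP (@Plq_pi (Cq R) (Cq_q R) (Cq_qV R)))
    (* the new variables t, tilde tau, tau, xi, eta *)
    (t : 'M[Plq (Cq_q R) (Cq_qV R)]_2)
    (ttau tau xi : 'rV[Plq (Cq_q R) (Cq_qV R)]_2)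
    (eta : 'cV[Plq (Cq_q R) (Cq_qV R)]_2)
    (ht : t *m Plq_x (Cq_q R) (Cq_qV R) = Plq_a_hilo (Cq_q R) (Cq_qV R))
    (httau : ttau *m Plq_x (Cq_q R) (Cq_qV R) = Plq_a_5lo (Cq_q R) (Cq_qV R))
    (htau : Plq_d (Cq_q R) (Cq_qV R) *: tau = ttau *m Plq_x (Cq_q R) (Cq_qV R))
    (hxi : Plq_d (Cq_q R) (Cq_qV R) *: xi = Plq_a_5hi (Cq_q R) (Cq_qV R))
    (heta : Plq_y (Cq_q R) (Cq_qV R) *m eta = Plq_a_hi5 (Cq_q R) (Cq_qV R)) :
  let x := Plq_x (Cq_q R) (Cq_qV R) in
  let y := Plq_y (Cq_q R) (Cq_qV R) in
  let d := Plq_d (Cq_q R) (Cq_qV R) in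
  let S := antipode HP in
  exists Dt : big_cell t ttau ->
              tens (Plq (Cq_q R) (Cq_qV R)) (big_cell t ttau),
    [/\ left_coaction HP Dt,
        (* Dt is the restriction of the comultiplication *)
        forall u, tens_map id (@cell_incl _ _ _ t ttau) (Dt u) =
                  comul HP (cell_incl u),
        forall i j : 'I_2,
          Dt (cell_t t ttau i j) =
            t i j \ox 1
            + \sum_(a < 2) \sum_(b < 2)
                (y i a * S (x b j)) \ox cell_t t ttau a b
            + \sum_(a < 2) \sum_(b < 2)
                (y i a * eta a 0 * S (x b j)) \ox cell_ttau t ttau b
      & forall j : 'I_2,
          Dt (cell_ttau t ttau j) =
            \sum_(a < 2)
              (d \ox 1)
              * (tau 0 a \ox 1
                 + \sum_(b < 2) xi 0 b \ox cell_t t ttau b a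
                 + 1 \ox cell_ttau t ttau a)
              * (S (x a j) \ox 1)].
Proof.
move=> x y d S.
have qK : Cq_q R * Cq_qV R = 1 := laurent_qK _.
have [phi [phi_mor phi_a phi_v]] := block_projection (Cq_q R) (Cq_qV R).
have comul_a i j : comul HP (Plq_a (Cq_q R) (Cq_qV R) i j) =
    \sum_(k < 5) Plq_a (Cq_q R) (Cq_qV R) i k \ox Plq_a (Cq_q R) (Cq_qV R) k j.
  have pl := smor_lin (Plq_pi_morphism (Cq_q R) (Cq_qV R)).
  rewrite (hopf_morphism_comul hP); have [-> _] := hSL i j.
  rewrite (lin_sum (tens_map_linear pl pl)); apply: eq_bigr => k _.
  by rewrite tens_mapE.
have counit_a i j : counit HP (Plq_a (Cq_q R) (Cq_qV R) i j) = (i == j)%:R.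
  by rewrite (hopf_morphism_counit hP); have [_ ->] := hSL i j.
apply: (big_cell_coaction_mx qK (@Plq_rel0 _ _ _) (@Plq_a_upper0 _ _ _)
  (@Plq_a_homog _ _ _) (Plq_DDV _ _) (Plq_DVD _ _) (@Plq_ind _ _ _)
  (@Plq_morph_ext _ _ _) phi_mor phi_a phi_v comul_a counit_a).
- move=> i l; have /matrixP/(_ i l) := ht; rewrite !mxE => <-.
  by apply: eq_bigr => j _; rewrite mxE.
- move=> l; have /matrixP/(_ 0 l) := httau; rewrite !mxE => <-.
  by apply: eq_bigr => j _; rewrite mxE.
- by move=> s [i j|j]; [left; exists i, j|right; exists j].
- move=> j; have /matrixP/(_ 0 j) := htau; rewrite httau !mxE.
  exact.
- move=> j; have /matrixP/(_ 0 j) := hxi; rewrite !mxE.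
  exact.
- move=> i; have /matrixP/(_ i 0) := heta; rewrite !mxE => <-.
  by apply: eq_bigr => j _; rewrite mxE.
- by move=> i j; rewrite mxE.
- by move=> i j; rewrite mxE.
- exact: erefl.
Qed.
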